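(* Let $\mathbf g=F\,dt^2+2G\,dt\,d\varphi+H\,d\varphi^2+R^2dr^2+\Sigma^2d\theta^2$ be a Kerr-like metric, where $F,G,H,R,\Sigma$ depend only on $(r,\theta)$, and let $\mathcal S(r)$ be a closed surface $t=\text{constant}$, $r=\text{constant}$, with induced metric $d\sigma^2=\Sigma^2d\theta^2+H\,d\varphi^2$. Suppose that the embedding $$X(\theta,\varphi)=(\eta(\theta)\cos\varphi,\ \eta(\theta)\sin\varphi,\ \xi(\theta)),\quad \eta(\theta)=H^{1/2},\quad \xi(\theta)=\int_{\pi/2}^{\theta}\left(\frac{-H_\theta^2+4H\Sigma^2}{4H}\right)^{1/2}d\theta$$ is defined for $\mathcal S(r)$, with $\eta(0)=\eta(\pi)=0$, and gives a smooth embedded closed surface of revolution in $\mathbb R^3$ (it is then an isometric embedding of $\mathcal S(r)$). Then $$E(\mathbf N,\Omega(r);0,0)=\mathfrak m_{\mathrm{BY}}(\mathcal S(r)).$$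
   Context: Coordinates: $0\le\theta\le\pi$, $0\le\varphi<2\pi$. The slice $\{t=t_0\}$ is assumed spacelike, with induced metric $H\,d\varphi^2+R^2dr^2+\Sigma^2d\theta^2$, where $R>0$, $\Sigma>0$, and $H>0$ for $0<\theta<\pi$. Subscripts $r,\theta$ denote partial derivatives. $\Omega(r)$ is the domain in the slice with boundary $\mathcal S(r)$, and $\mathbf N=\partial_T$ is the timelike Killing field of the reference Minkowski spacetime with metric $-dT^2+dX^2+dY^2+dZ^2$. The quasilocal energy, for functions $x(\theta),y(\theta)$, is $$E(\mathbf N,\Omega(r);x,y)=-\int_0^{2\pi}\left(\int_0^\pi\left(\frac{AH_\theta}{D}\frac{xy}{\beta\ell}+\frac AD\frac{\alpha}{\ell}+\frac CD\frac1\beta\right)d\theta\right)d\varphi,$$ where $A=\Sigma(H\Sigma^2)_r$, $C=2HR^2(H_{\theta\theta}\Sigma-H_\theta\Sigma_\theta-2\Sigma^3)$, $D=16\pi H^{1/2}R^2\Sigma$, $\alpha=(x^2\Sigma^2+R^2(y^2+\Sigma^2))^{1/2}$, $\beta=(-H_\theta^2+4H(y^2+\Sigma^2))^{1/2}$, $\ell=y^2+\Sigma^2$. The Brown-York mass (quasilocal energy) of $\mathcal S(r)$ with respect to the slice $t=\text{constant}$ is $$\mathfrak m_{\mathrm{BY}}(\mathcal S(r))=\frac1{8\pi}\int_{\mathcal S(r)}(\kappa_0-\kappa)\,d\sigma,$$ where $\kappa$ is the mean curvature of $\mathcal S(r)$ in the slice with respect to the unit normal $\nu=R^{-1}\partial_r$,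 $\kappa_0$ is the mean curvature, with respect to the outward unit normal, of $\mathcal S(r)$ isometrically embedded in $\mathbb R^3$ by $X$, and $d\sigma$ is the area element. Mean curvature is the sum of the principal curvatures, with the sign for which round spheres in $\mathbb R^3$ have positive mean curvature with respect to the outward normal. *)

(* Defs.v *)
From HB Require Import structures.
From mathcomp Require Import all_boot all_order all_algebra.
From mathcomp Require Import all_classical all_reals all_analysis.
Import Order.TTheory GRing.Theory Num.Theory.
Import numFieldNormedType.Exports.

Set Implicit Arguments.
Unset Strict Implicit.
Unset Printing Implicit Defensive.

Local Open Scope classical_set_scope.
Local Open Scope ring_scope.

Definition partial (R : realType) n (i : 'I_n) (f : 'rV[R]_n -> R)
  (x : 'rV[R]_n) : R := 'D_(delta_mx 0 i) f x.

(* C^k on D; meant for open D, so that the partial derivatives only involve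
   values of f on D. *)
Fixpoint Ck_on (R : realType) n (k : nat) (D : set 'rV[R]_n)
    (f : 'rV[R]_n -> R) : Prop :=
  (forall x, D x -> {for x, continuous f}) /\
  (if k is k'.+1 then
     forall i : 'I_n, (forall x, D x -> derivable f x (delta_mx 0 i)) /\
                      Ck_on k' D (partial i f)
   else True).

Definition smooth_on (R : realType) n (D : set 'rV[R]_n) (f : 'rV[R]_n -> R) :=
  forall k, Ck_on k D f.

Definition dot (R : realType) n (u v : 'rV[R]_n) : R := \sum_i u 0 i * v 0 i.

Definition oriented_integral (R : realType) (a b : R) (f : R -> R) : R :=
  let mu := @lebesgue_measure R in
  if a <= b then \int[mu]_(t in `[a, b]) f t
  else - \int[mu]_(t in `[b, a]) f t.

(******************************************************************************)
(* Pseudo-Riemannian metrics in coordinates: g x is the matrix of the metric  *)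
(* at the point with coordinates x.                                           *)
(******************************************************************************)

(* Metric induced on the coordinate hypersurface {x_0 = c}, in the remaining
   coordinates. *)
Definition section_metric (R : realType) n (g : 'rV[R]_(1 + n) -> 'M[R]_(1 + n))
  (c : R) (q : 'rV[R]_n) : 'M[R]_n := drsubmx (g (row_mx c%:M q)).

Definition christoffel (R : realType) n (g : 'rV[R]_n -> 'M[R]_n)
  (x : 'rV[R]_n) (k i j : 'I_n) : R :=
  2^-1 * \sum_l invmx (g x) k l *
    (partial i (fun y => g y j l) x + partial j (fun y => g y i l) x
     - partial l (fun y => g y i j) x).

(* Row i holds the components of the covariant derivative of N along d_i. *)
Definition covariant_derivative (R : realType) n (g : 'rV[R]_n -> 'M[R]_n)
  (N : 'rV[R]_n -> 'rV[R]_n) (x : 'rV[R]_n) : 'M[R]_n :=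
  \matrix_(i, k) (partial i (fun y => N y 0 k) x
                  + \sum_j christoffel g x k i j * N x 0 j).

(* Mean curvature of {x_0 = c} at q with respect to the unit normal N: the
   second fundamental form is h(d_a, d_b) = g(nabla_a N, d_b), and the sum of
   the principal curvatures is the trace of the shape operator. *)
Definition section_mean_curvature (R : realType) n
  (g : 'rV[R]_(1 + n) -> 'M[R]_(1 + n)) (N : 'rV[R]_(1 + n) -> 'rV[R]_(1 + n))
  (c : R) (q : 'rV[R]_n) : R :=
  let x := row_mx c%:M q in
  \tr (invmx (section_metric g c q)
       *m drsubmx (covariant_derivative g N x *m g x)).

(* Compact subsets that are locally regular level sets of smooth functions. *)
Definition smooth_closed_surface (R : realType) (S : set 'rV[R]_3) : Prop :=
  [/\ S !=set0, compact S &
      forall p, S p -> exists (U : set 'rV[R]_3) (f : 'rV[R]_3 -> R),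
        [/\ open U, U p, smooth_on U f,
            forall q, U q -> (S q <-> f q = 0) &
            forall q, U q -> exists i, partial i f q != 0]].

(* Points of the complement of S in an unbounded component. *)
Definition exterior (R : realType) (S : set 'rV[R]_3) : set 'rV[R]_3 :=
  [set p | ~ S p /\ ~ bounded_set (connected_component (~` S) p)].

Definition tangent (R : realType) (X : 'rV[R]_2 -> 'rV[R]_3) (a : 'I_2)
  (u : 'rV[R]_2) : 'rV[R]_3 := \row_k partial a (fun v => X v 0 k) u.

Definition first_fundamental_form (R : realType) (X : 'rV[R]_2 -> 'rV[R]_3)
  (u : 'rV[R]_2) : 'M[R]_2 :=
  \matrix_(a, b) dot (tangent X a u) (tangent X b u).

Definition is_outward_unit_normal (R : realType) (S : set 'rV[R]_3)
  (X : 'rV[R]_2 -> 'rV[R]_3) (u : 'rV[R]_2) (N : 'rV[R]_3) : Prop :=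
  [/\ dot N N = 1, forall a, dot (tangent X a u) N = 0 &
      \forall s \near 0^'+, exterior S (X u + s *: N)].

Definition outward_unit_normal (R : realType) (S : set 'rV[R]_3)
  (X : 'rV[R]_2 -> 'rV[R]_3) (u : 'rV[R]_2) : 'rV[R]_3 :=
  [get N | is_outward_unit_normal S X u N].

(* h(d_a, d_b) = <d_a N, d_b X> = - <d_a d_b X, N> for the outward normal N,
   so that round spheres have positive mean curvature. *)
Definition second_fundamental_form (R : realType) (S : set 'rV[R]_3)
  (X : 'rV[R]_2 -> 'rV[R]_3) (u : 'rV[R]_2) : 'M[R]_2 :=
  \matrix_(a, b) - dot (tangent (tangent X b) a u) (outward_unit_normal S X u).

Definition outward_mean_curvature (R : realType) (S : set 'rV[R]_3)
  (X : 'rV[R]_2 -> 'rV[R]_3) (u : 'rV[R]_2) : R :=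
  \tr (invmx (first_fundamental_form X u) *m second_fundamental_form S X u).

(* Points of 'rV_2 are pairs (theta, phi) of spherical coordinates. *)
Definition chart (R : realType) : set 'rV[R]_2 := [set u | 0 < u 0 0 < pi].

Definition sphere (R : realType) : set 'rV[R]_2 :=
  [set u | 0 <= u 0 0 <= pi /\ 0 <= u 0 1 < 2 * pi].

(* Coordinates of the same point of the sphere: phi is irrelevant at poles. *)
Definition same_point (R : realType) (u v : 'rV[R]_2) : Prop :=
  u 0 0 = v 0 0 /\ (0 < u 0 0 < pi -> u 0 1 = v 0 1).

(* X is a smooth embedding in spherical coordinates, and the closed surface it
   parametrizes is smooth, at the poles as well. *)
Definition gives_smooth_embedded_closed_surface (R : realType)
  (X : 'rV[R]_2 -> 'rV[R]_3) : Prop :=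
  [/\ forall k, smooth_on (@chart R) (fun u => X u 0 k),
      forall u, chart u -> first_fundamental_form X u \in unitmx,
      forall u v, sphere u -> sphere v -> X u = X v -> same_point u v &
      smooth_closed_surface (X @` @sphere R)].

(******************************************************************************)
(* Kerr-like metrics, with coordinates ordered as (t, r, theta, phi)          *)
(******************************************************************************)

(* Coefficients as functions of r and theta; gR and gS are the functions
   called R and Sigma. *)
Record kerr_like (R : realType) := KerrLike {
  gF : R -> R -> R;
  gG : R -> R -> R;
  gH : R -> R -> R;
  gR : R -> R -> R;
  gS : R -> R -> R }.

Definition spacetime_metric (R : realType) (K : kerr_like R) (x : 'rV[R]_4) :
    'M[R]_4 :=
  let r := x 0 1 in let th := x 0 2 in
  \matrix_(i, j) nth 0 (nth [::]
    [:: [:: gF K r th; 0;             0;             gG K r th];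
        [:: 0;         gR K r th ^+ 2; 0;             0        ];
        [:: 0;         0;             gS K r th ^+ 2; 0        ];
        [:: gG K r th; 0;             0;             gH K r th]] i) j.

(* Metric of the slice {t = t0} in the coordinates (r, theta, phi). *)
Definition slice_metric (R : realType) (K : kerr_like R) (t0 : R) :
    'rV[R]_3 -> 'M[R]_3 := @section_metric R 3 (spacetime_metric K) t0.

(* Metric of the surface S(r) in the coordinates (theta, phi). *)
Definition surface_metric (R : realType) (K : kerr_like R) (t0 r : R) :
    'rV[R]_2 -> 'M[R]_2 := @section_metric R 2 (slice_metric K t0) r.

Definition slice_normal (R : realType) (K : kerr_like R) (q : 'rV[R]_3) :
    'rV[R]_3 := (gR K (q 0 0) (q 0 1))^-1 *: delta_mx 0 0.

Definition d_r (R : realType) (f : R -> R -> R) (r th : R) : R :=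
  derive1 (fun s => f s th) r.
Definition d_th (R : realType) (f : R -> R -> R) (r th : R) : R := derive1 (f r) th.

Definition on_plane (R : realType) (f : R -> R -> R) (v : 'rV[R]_2) : R :=
  f (v 0 0) (v 0 1).

(* Regularity over r in I: smooth off the axis, continuous up to the axis. *)
Definition smooth_coefficient (R : realType) (I : set R) (f : R -> R -> R) :=
  smooth_on [set v : 'rV[R]_2 | I (v 0 0) /\ 0 < v 0 1 < pi] (on_plane f) /\
  {within [set v : 'rV[R]_2 | I (v 0 0) /\ 0 <= v 0 1 <= pi], continuous (on_plane f)}.

Definition smooth_kerr_like (R : realType) (I : set R) (K : kerr_like R) :=
  [/\ smooth_coefficient I (gF K), smooth_coefficient I (gG K),
      smooth_coefficient I (gH K), smooth_coefficient I (gR K) &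
      smooth_coefficient I (gS K)].

Definition spacelike_slice (R : realType) (I : set R) (K : kerr_like R) :=
  forall r th, I r -> 0 <= th <= pi ->
    [/\ 0 < gR K r th, 0 < gS K r th & 0 < th < pi -> 0 < gH K r th].

Definition eta (R : realType) (K : kerr_like R) (r th : R) : R :=
  Num.sqrt (gH K r th).

Definition xi_radicand (R : realType) (K : kerr_like R) (r th : R) : R :=
  (- d_th (gH K) r th ^+ 2 + 4 * gH K r th * gS K r th ^+ 2) / (4 * gH K r th).

Definition xi (R : realType) (K : kerr_like R) (r th : R) : R :=
  oriented_integral (pi / 2) th (fun t => Num.sqrt (xi_radicand K r t)).

Definition embedding (R : realType) (K : kerr_like R) (r : R) (u : 'rV[R]_2) :
    'rV[R]_3 :=
  let th := u 0 0 in let phi := u 0 1 in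
  \row_k nth 0 [:: eta K r th * cos phi; eta K r th * sin phi; xi K r th] k.

(* Num.sqrt is 0 on negative numbers, so reality of the square root has to be
   stated. *)
Definition embedding_defined (R : realType) (K : kerr_like R) (r : R) : Prop :=
  forall th, 0 < th < pi -> 0 <= xi_radicand K r th.

Definition isometric_embedding (R : realType) (K : kerr_like R) (t0 r : R)
  (X : 'rV[R]_2 -> 'rV[R]_3) : Prop :=
  forall u, chart u -> first_fundamental_form X u = surface_metric K t0 r u.

Definition brown_york_mass (R : realType) (K : kerr_like R) (t0 r : R)
  (X : 'rV[R]_2 -> 'rV[R]_3) : R :=
  let mu := @lebesgue_measure R in
  let kappa := @section_mean_curvature R 2 (slice_metric K t0) (slice_normal K) r in
  let kappa0 := outward_mean_curvature (X @` @sphere R) X in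
  let dsigma u := Num.sqrt (\det (surface_metric K t0 r u)) in
  (8 * pi)^-1 *
  \int[mu]_(phi in `[0, 2 * pi]) \int[mu]_(th in `[0, pi])
    let u := \row_k nth 0 [:: th; phi] k in
    (kappa0 u - kappa u) * dsigma u.

(* E(N, Omega(r); x, y); the observer N = d_T and the domain Omega(r) only
   enter through this expression. *)
Definition quasilocal_energy (R : realType) (K : kerr_like R) (r : R)
  (x y : R -> R) : R :=
  let mu := @lebesgue_measure R in
  let H := gH K r in let Rr := gR K r in let S := gS K r in
  let H_th := d_th (gH K) r in
  let H_thth := d_th (d_th (gH K)) r in
  let S_th := d_th (gS K) r in
  let A th := S th * d_r (fun s t => gH K s t * gS K s t ^+ 2) r th in
  let C th := 2 * H th * Rr th ^+ 2 *
    (H_thth th * S th - H_th th * S_th th - 2 * S th ^+ 3) in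
  let D th := 16 * pi * Num.sqrt (H th) * Rr th ^+ 2 * S th in
  let ell th := y th ^+ 2 + S th ^+ 2 in
  let alpha th := Num.sqrt (x th ^+ 2 * S th ^+ 2 + Rr th ^+ 2 * ell th) in
  let beta th := Num.sqrt (- H_th th ^+ 2 + 4 * H th * ell th) in
  - \int[mu]_(phi in `[0, 2 * pi]) \int[mu]_(th in `[0, pi])
      (A th * H_th th / D th * (x th * y th / (beta th * ell th))
       + A th / D th * (alpha th / ell th)
       + C th / D th * (beta th)^-1).

(* Main.v *)
Require Import Defs.
From mathcomp Require Import all_boot all_order all_algebra.
From mathcomp Require Import all_classical all_reals all_analysis.
From mathcomp Require Import measurable_realfun ring lra.
Import Order.TTheory GRing.Theory Num.Theory.
Import numFieldNormedType.Exports.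

(* Write s = Sigma, e = eta = H^(1/2), and denote theta-derivatives by primes.
   The embedding satisfies e'^2 + xi'^2 = s^2, and the integrands of the two
   sides agree pointwise. The term of E with A is kappa dsigma / (8 pi). For the
   other one, beta = 2 e xi' and C / (D beta) = - kappa0 dsigma / (8 pi), with
   kappa0 = (xi'' e' - e'' xi') / s^3 + xi' / (s e).

   Two points need care. First, this kappa0 is the curvature for the normal
   (xi' e_r - e' e_z) / s, which must be shown to point to the unbounded side of
   the surface. As xi is nondecreasing, the region |q| <= e(theta),
   z = xi(theta) is closed, and so is its counterpart |q| >= e(theta); together
   they cover the space and meet only in the surface. Hence no component of the
   complement leaves the first region, which is bounded, while from a point
   outside it one escapes radially. Where xi' > 0, the first-order behaviour of
   the profile decides on which side the displaced points lie. Second, where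
   xi' = 0 the quotient 1 / beta is 0 by convention; since xi' >= 0 is then
   minimal, xi'' = 0 and kappa0 = 0 whatever the normal is. *)

Set Implicit Arguments.
Unset Strict Implicit.
Unset Printing Implicit Defensive.

Local Open Scope classical_set_scope.
Local Open Scope ring_scope.

(** * Integrals and partial derivatives *)

(** The right-hand side is the difference quotient at [x 0 i] of a function of one real variable, so
    partial derivatives become ordinary derivatives along coordinate lines. *)
Lemma line_quotient (R : realType) n (i : 'I_n) (f : 'rV[R]_n -> R) x :
  (fun h : R => h^-1 *: (f (h *: delta_mx 0 i + x) - f x)) =
  (fun h : R => h^-1 *: (f (x + (h *: 1 + x 0 i - x 0 i) *: delta_mx 0 i)
                         - f (x + (x 0 i - x 0 i) *: delta_mx 0 i))).
Proof.
apply/funext => h.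
by rewrite subrr scale0r addr0 [_ *: 1]mulr1 addrK [x + _]addrC.
Qed.

Lemma partialE (R : realType) n (i : 'I_n) (f : 'rV[R]_n -> R) x :
  partial i f x =
  'D_1 (fun t : R => f (x + (t - x 0 i) *: delta_mx 0 i)) (x 0 i).
Proof. by rewrite /partial /derive line_quotient. Qed.

Lemma derivable_lineE (R : realType) n (i : 'I_n) (f : 'rV[R]_n -> R) x :
  derivable f x (delta_mx 0 i) =
  derivable (fun t : R => f (x + (t - x 0 i) *: delta_mx 0 i)) (x 0 i) 1.
Proof. by rewrite /derivable line_quotient. Qed.

(** * Scaling of integrals by a constant *)

Section unconditional_scaling.
Local Open Scope ereal_scope.
Context d (T : measurableType d) (R : realType).
Variable mu : {measure set T -> \bar R}.
Import HBNNSimple.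

(** The supremum over simple functions that defines the integral of a nonnegative function. A
    positive factor [c] carries the simple functions below [f] onto those below [c f], so scaling
    holds without measurability of [f]. *)
Let nn (f : T -> \bar R) := ereal_sup [set sintegral mu h |
  h in [set h : {nnsfun T >-> R} | forall x, (h x)%:E <= f x]].

Let nn_scale_le (f : T -> \bar R) (c : R) : (0 < c)%R ->
  c%:E * nn f <= nn (fun x => c%:E * f x).
Proof.
move=> c0; rewrite -lee_pdivlMl//; apply: ge_ereal_sup => _ [h /= hf <-].
rewrite lee_pdivlMl//; apply: ereal_sup_ubound => /=.
exists (scale_nnsfun h (ltW c0)).
  by move=> x /=; rewrite EFinM lee_pmul2l// ?lte_fin.
by rewrite -sintegralrM.
Qed.


Let nn_scale (f : T -> \bar R) (c : R) : (0 < c)%R ->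
  nn (fun x => c%:E * f x) = c%:E * nn f.
Proof.
move=> c0; apply/eqP; rewrite eq_le nn_scale_le// andbT.
have c'0 : (0 < c^-1)%R by rewrite invr_gt0.
(* The reverse inequality is the first one applied to [c f] with the factor [c^-1]. *)
have := nn_scale_le (fun x => c%:E * f x) c'0.
have -> : (fun x => c^-1%:E * (c%:E * f x)) = f.
  by apply/funext => x; rewrite muleA -EFinM mulVf ?gt_eqF// mul1e.
by rewrite lee_pdivrMl.
Qed.

Let fine_scaleB (c : R) (a b : \bar R) : (0 < c)%R ->
  fine (c%:E * a - c%:E * b) = (c * fine (a - b))%R.
Proof.
move=> c0; case: a b => [a| |] [b| |] //=;
  rewrite ?(gt0_muley, gt0_muleNy) ?lte_fin//= ?mulr0//.
by rewrite mulrBr.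
Qed.

(* No integrability is assumed: [fine] sends infinite and undefined integrals
   to [0] on both sides. *)
Lemma RintegralZl_any (D : set T) (f : T -> R) (c : R) :
  (\int[mu]_(x in D) (c * f x) = c * \int[mu]_(x in D) f x)%R.
Proof.
have [->|c_neq0] := eqVneq c 0%R.
  rewrite /Rintegral; under eq_integral do rewrite mul0r.
  by rewrite integral0 mul0r.
rewrite /Rintegral /integral -!/(nn _).
have -> : (fun x => (c * f x)%:E) \_ D
          = (fun x => c%:E * ((fun x => (f x)%:E) \_ D) x).
  by apply/funext => x; rewrite /patch; case: ifP; rewrite ?mule0.
set g := (fun x => (f x)%:E) \_ D.
(* A negative factor exchanges the positive and negative parts, so the difference of their integrals
   is reversed. *)
have fineBC (a b : \bar R) : fine (b - a) = (- fine (a - b))%R.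
  by case: a b => [a| |] [b| |] //=; rewrite ?oppr0// opprB.
move: c_neq0; rewrite neq_lt => /orP[c0|c0].
- rewrite le0_funeposM ?ltW// le0_funenegM ?ltW// !nn_scale ?oppr_gt0//.
  by rewrite fine_scaleB ?oppr_gt0// fineBC mulrNN.
- rewrite ge0_funeposM ?ltW// ge0_funenegM ?ltW// !nn_scale//.
  exact: fine_scaleB.
Qed.

End unconditional_scaling.

(* Stated in the syntactic form used in [brown_york_mass]. *)
Definition pt (R : realType) (a b : R) : 'rV[R]_2 :=
  \row_k nth 0 [:: a; b] k.

Lemma pt0 (R : realType) (a b : R) : pt a b 0 0 = a.
Proof. by rewrite mxE. Qed.

Lemma pt1 (R : realType) (a b : R) : pt a b 0 1 = b.
Proof. by rewrite mxE. Qed.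

Lemma pt_coord (R : realType) (u : 'rV[R]_2) : pt (u 0 0) (u 0 1) = u.
Proof.
apply/rowP => k; rewrite mxE; case: k => -[|[|//]] i /=;
  by congr (u _ _); apply: val_inj.
Qed.

Lemma line_pt0 (R : realType) (u : 'rV[R]_2) t :
  u + (t - u 0 0) *: delta_mx 0 0 = pt t (u 0 1).
Proof.
apply/rowP => k; rewrite !mxE; case: k => -[|[|//]] i /=.
  by rewrite (_ : Ordinal i = 0)//= ?mulr1 ?subrKC//; apply: val_inj.
by rewrite (_ : Ordinal i = 1)//= ?mulr0 ?addr0//; apply: val_inj.
Qed.

Lemma line_pt1 (R : realType) (u : 'rV[R]_2) t :
  u + (t - u 0 1) *: delta_mx 0 1 = pt (u 0 0) t.
Proof.
apply/rowP => k; rewrite !mxE; case: k => -[|[|//]] i /=.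
  by rewrite (_ : Ordinal i = 0)//= ?mulr0 ?addr0//; apply: val_inj.
by rewrite (_ : Ordinal i = 1)//= ?mulr1 ?subrKC//; apply: val_inj.
Qed.

Lemma partial0E (R : realType) (f : 'rV[R]_2 -> R) u :
  partial 0 f u = 'D_1 (fun t => f (pt t (u 0 1))) (u 0 0).
Proof. by rewrite partialE; under eq_fun do rewrite line_pt0. Qed.

Lemma partial1E (R : realType) (f : 'rV[R]_2 -> R) u :
  partial 1 f u = 'D_1 (fun t => f (pt (u 0 0) t)) (u 0 1).
Proof. by rewrite partialE; under eq_fun do rewrite line_pt1. Qed.

Lemma derivable0E (R : realType) (f : 'rV[R]_2 -> R) u :
  derivable f u (delta_mx 0 0) =
  derivable (fun t => f (pt t (u 0 1))) (u 0 0) 1.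
Proof. by rewrite derivable_lineE; under eq_fun do rewrite line_pt0. Qed.

Lemma derivable1E (R : realType) (f : 'rV[R]_2 -> R) u :
  derivable f u (delta_mx 0 1) =
  derivable (fun t => f (pt (u 0 0) t)) (u 0 1) 1.
Proof. by rewrite derivable_lineE; under eq_fun do rewrite line_pt1. Qed.

Lemma continuous_line (R : realType) n (x v : 'rV[R]_n) (a : R) :
  continuous (fun t : R => x + (t - a) *: v).
Proof.
move=> t; apply: cvgD; first exact: cvg_cst.
by apply: cvgZr_tmp; apply: cvgB; [exact: cvg_id|exact: cvg_cst].
Qed.

Lemma continuous_pt1 (R : realType) (a : R) : continuous (fun t : R => pt a t).
Proof.
have -> : (fun t : R => pt a t) = fun t => pt a 0 + (t - 0) *: delta_mx 0 1.
  by apply/funext => t; have := line_pt1 (pt a 0) t; rewrite pt0 pt1.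
exact: continuous_line.
Qed.

Lemma on_plane_pt0 (R : realType) (f : R -> R -> R) b :
  (fun t => on_plane f (pt t b)) = f ^~ b.
Proof. by apply/funext => t; rewrite /on_plane pt0 pt1. Qed.

Lemma on_plane_pt1 (R : realType) (f : R -> R -> R) a :
  (fun t => on_plane f (pt a t)) = f a.
Proof. by apply/funext => t; rewrite /on_plane pt0 pt1. Qed.

Section coefficients.
Context (R : realType) (I : set R) (f : R -> R -> R) (r : R).
Hypotheses (Ir : I r) (fI : smooth_coefficient I f).

Lemma coefficient_derivable_r th : 0 < th < pi -> derivable (f ^~ th) r 1.
Proof.
move=> th_pi; have [_ /(_ 0)[/(_ (pt r th)) + _]] := fI.1 1%N.
rewrite derivable0E /= !pt0 !pt1 on_plane_pt0; exact.
Qed.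

Lemma coefficient_derivable_th th : 0 < th < pi -> derivable (f r) th 1.
Proof.
move=> th_pi; have [_ /(_ 1)[/(_ (pt r th)) + _]] := fI.1 1%N.
rewrite derivable1E /= !pt0 !pt1 on_plane_pt1; exact.
Qed.

(** Joint continuity up to the axis is restricted along [pt r], which maps [[0, pi]] into the closed
    domain. *)
Lemma coefficient_within : {within `[0, pi], continuous (f r)}.
Proof.
have /subspace_continuousP fc := fI.2.
apply/subspace_continuousP => th /=; rewrite in_itv/= => th_pi.
have fcth := fc (pt r th).
rewrite /= pt0 pt1 in fcth; move: {fcth}(fcth (conj Ir th_pi)).
rewrite /from_subspace {2}/on_plane pt0 pt1 => fcth.
rewrite -[X in X @ _](on_plane_pt1 f r) -/(on_plane f \o pt r).
apply: cvg_comp fcth => P; rewrite /within/= => /continuous_pt1 /= nP.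
change (nbhs th (fun t => [set` `[0, pi]] t -> P (pt r t))).
apply: (@filterS _ (nbhs th) _ _ _ _ nP) => t /= + t_pi.
by apply; split; rewrite ?pt0 ?pt1//; move: t_pi; rewrite /= in_itv.
Qed.

End coefficients.

(** Through this lemma, smoothness of the components of the embedding yields two derivatives of the
    profile functions [eta] and [xi]. *)
Lemma smooth_on_line0 (R : realType) (f : R -> R -> R) (phi th : R) :
  smooth_on (@chart R) (on_plane f) -> 0 < th < pi ->
  derivable (f ^~ phi) th 1 /\ derivable (derive1 (f ^~ phi)) th 1.
Proof.
move=> fS th_pi.
have D : chart (pt th phi) by rewrite /chart/= pt0.
have [_ /(_ 0)[/(_ _ D) d1 [_ /(_ 0)[/(_ _ D) d2 _]]]] := fS 2%N.
split.
  by move: d1; rewrite derivable0E pt0 pt1 on_plane_pt0.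
have E : (fun t => partial 0 (on_plane f) (pt t phi)) = (derive1 (f ^~ phi)).
  by apply/funext => t; rewrite partial0E derive1E pt0 pt1 on_plane_pt0.
rewrite derivable0E pt0 pt1 in d2.
rewrite E in d2.
exact: d2.
Qed.

(** * Mean curvature in the slice *)

Lemma invmx_diag (F : fieldType) n (v : 'rV[F]_n) :
  (forall i, v 0 i != 0) ->
  invmx (diag_mx v) = diag_mx (\row_i (v 0 i)^-1).
Proof.
move=> v0; have E : diag_mx v *m diag_mx (\row_i (v 0 i)^-1) = 1%:M.
  apply/matrixP => i j; rewrite mul_diag_mx !mxE.
  by case: eqP => [->|_]; rewrite ?mulr0// mulr1n mulfV.
have [U _] := mulmx1_unit E.
by rewrite -[LHS]mulmx1 -E mulmxA mulVmx// mul1mx.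
Qed.

Lemma row_mx_scalar0 (R : nzRingType) n (c : R) (q : 'rV[R]_n) (j : 'I_(1 + n)) :
  val j = 0%N -> row_mx c%:M q 0 j = c.
Proof.
move=> j0; rewrite (_ : j = lshift n ord0) ?row_mxEl ?mxE//.
exact: val_inj.
Qed.

Lemma row_mx_scalarS (R : nzRingType) n (c : R) (q : 'rV[R]_n) (i : 'I_n)
  (j : 'I_(1 + n)) : val j = i.+1 -> row_mx c%:M q 0 j = q 0 i.
Proof.
by move=> ji; rewrite (_ : j = rshift 1 i) ?row_mxEr//; apply: val_inj.
Qed.

Definition slice_diag (R : realType) (K : kerr_like R) (q : 'rV[R]_3) : 'rV[R]_3 :=
  let r := q 0 0 in let th := q 0 1 in
  \row_k nth 0 [:: gR K r th ^+ 2; gS K r th ^+ 2; gH K r th] k.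

Lemma slice_metricE (R : realType) (K : kerr_like R) (t0 : R) q :
  slice_metric K t0 q = diag_mx (slice_diag K q).
Proof.
rewrite /slice_metric /section_metric /spacetime_metric.
rewrite (@row_mx_scalarS _ _ _ _ 0)// (@row_mx_scalarS _ _ _ _ 1)//.
apply/matrixP => i j; rewrite !mxE.
by case: i j => -[|[|[|//]]] ? [[|[|[|//]]]] ?.
Qed.

Lemma surface_metricE (R : realType) (K : kerr_like R) (t0 r : R) u :
  surface_metric K t0 r u =
  diag_mx (pt (gS K r (u 0 0) ^+ 2) (gH K r (u 0 0))).
Proof.
rewrite /surface_metric /section_metric slice_metricE /slice_diag.
rewrite row_mx_scalar0// (@row_mx_scalarS _ _ _ _ 0)//.
apply/matrixP => i j; rewrite !mxE.
by case: i j => -[|[|//]] ? [[|[|//]]] ?.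
Qed.

Lemma partial_cst (R : realType) n (i : 'I_n) (c : R) x :
  partial i (fun=> c) x = 0.
Proof. exact: derive_cst. Qed.

(** In the sum over [l] only [l = k] survives, since the inverse metric is diagonal; as [j != k],
    two of the three derivatives there are of off-diagonal entries, which vanish identically. *)
Lemma christoffel_diag (R : realType) n (g : 'rV[R]_n -> 'M[R]_n)
  (D : 'rV[R]_n -> 'rV[R]_n) (x : 'rV[R]_n) (k j : 'I_n) :
  (forall y, g y = diag_mx (D y)) -> (forall i, D x 0 i != 0) -> j != k ->
  christoffel g x k k j =
  2^-1 * ((D x 0 k)^-1 * partial j (fun y => D y 0 k) x).
Proof.
move=> gD Dx0 jk; rewrite /christoffel; congr (_ * _).
rewrite gD invmx_diag// (bigD1 k)//= big1 ?addr0; last first.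
  by move=> l lk; rewrite !mxE eq_sym (negbTE lk) mul0r.
rewrite !mxE eqxx mulr1n; congr (_ * _).
have offdiag a b : a != b -> (fun y => g y a b) = fun=> 0.
  by move=> ab; apply/funext => y; rewrite gD mxE (negbTE ab).
rewrite (offdiag j k)// (offdiag k j) 1?eq_sym// !partial_cst add0r subr0.
by congr partial; apply/funext => y; rewrite gD mxE eqxx.
Qed.

(** The normal has only its component along [d_0], so a diagonal entry of its covariant derivative
    in a tangential direction reduces to one Christoffel symbol, and [f] is never differentiated. *)
Lemma section_mean_curvature_diag (R : realType) n
    (g : 'rV[R]_(1 + n) -> 'M[R]_(1 + n)) (D : 'rV[R]_(1 + n) -> 'rV[R]_(1 + n))
    (f : 'rV[R]_(1 + n) -> R) (c : R) (q : 'rV[R]_n) :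
  let x := row_mx c%:M q in
  (forall y, g y = diag_mx (D y)) -> (forall i, D x 0 i != 0) ->
  section_mean_curvature g (fun y => f y *: delta_mx 0 0) c q =
  \sum_(i < n) 2^-1 * f x * (D x 0 (rshift 1 i))^-1 *
               partial 0 (fun y => D y 0 (rshift 1 i)) x.
Proof.
move=> x gD Dx0; rewrite /section_mean_curvature.
have -> : section_metric g c q = diag_mx (rsubmx (D x)).
  apply/matrixP => i j; rewrite /section_metric gD !mxE -/x.
  by rewrite (inj_eq (@rshift_inj _ _)).
rewrite invmx_diag => [|i]; last by rewrite mxE.
apply: eq_bigr => i _; rewrite mul_diag_mx mxE mxE mxE gD.
rewrite [X in _ * X](_ : _ = (covariant_derivative g (fun y => f y *: 'e_0) x *m diag_mx (D x)) (rshift 1 i) (rshift 1 i)); last by rewrite !mxE.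
rewrite mul_mx_diag !mxE.
have i0 (j : 'I_(1 + n)) : val j = 0%N -> (rshift 1 i == j) = false.
  by move=> j0; apply/eqP => /(congr1 val); rewrite j0.
have -> : (fun y => (f y *: 'e_0 : 'rV_(1 + n)) 0 (rshift 1 i)) = fun=> 0.
  by apply/funext => y; rewrite !mxE i0// mulr0.
rewrite partial_cst add0r (bigD1 0)//= big1 ?addr0 => [|j j0]; last first.
  by rewrite !mxE (negbTE j0) !mulr0.
rewrite !mxE !eqxx mulr1 (christoffel_diag gD)//.
by field; rewrite Dx0.
Qed.

(** The bracket is the logarithmic [r]-derivative of the area density [Sigma H^(1/2)]. The metric
    contains [Sigma] squared, whose derivative is expanded by the product rule. *)
Lemma slice_mean_curvature (R : realType) (K : kerr_like R) (t0 r th phi : R) :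
  gR K r th != 0 -> gS K r th != 0 -> gH K r th != 0 ->
  derivable (fun s => gS K s th) r 1 ->
  @section_mean_curvature R 2 (slice_metric K t0) (slice_normal K) r (pt th phi) =
  (gR K r th)^-1 * (d_r (gS K) r th / gS K r th
                    + d_r (gH K) r th / (2 * gH K r th)).
Proof.
move=> R0 S0 H0 dS.
set x := row_mx r%:M (pt th phi) : 'rV[R]_(1 + 2).
have x0 : x 0 0 = r by rewrite row_mx_scalar0.
have x1 : x 0 1 = th by rewrite (@row_mx_scalarS _ _ _ _ 0)// pt0.
rewrite (section_mean_curvature_diag _ (slice_metricE K t0)) -/x; last first.
  move=> i; rewrite mxE x0 x1.
  by case: i => -[|[|[|//]]] ? /=; rewrite ?expf_neq0.
clearbody x; have line0 t : (x + (t - r) *: delta_mx 0 0) 0 0 = t.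
  by rewrite !mxE !eqxx mulr1 x0 subrKC.
have line1 t : (x + (t - r) *: delta_mx 0 0) 0 1 = th.
  by rewrite !mxE mulr0 addr0.
rewrite !big_ord_recl big_ord0 addr0 !mxE /= x0 x1 !partialE.
rewrite x0.
have -> : (fun t => slice_diag K (x + (t - r) *: 'e_0) 0 (rshift 1 ord0)) =
          fun t => gS K t th ^+ 2.
  by apply/funext => t; rewrite mxE line0 line1.
have -> : (fun t => slice_diag K (x + (t - r) *: 'e_0) 0
                       (rshift 1 (lift ord0 ord0))) = (gH K)^~ th.
  by apply/funext => t; rewrite mxE line0 line1.
have -> : (fun t => gS K t th ^+ 2) = (gS K)^~ th * (gS K)^~ th.
  by apply/funext => t; rewrite expr2.
rewrite (deriveM dS dS) /d_r !derive1E /GRing.scale/=; field.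
by rewrite R0 S0 H0.
Qed.

(** * The solid bounded by a surface of revolution *)

(** The set is the projection, along the compact factor [A], of a closed subset of [A * T]. The
    complement is shown open by a tube argument, with compactness as a near covering. *)
Lemma closed_fiber (R : realType) (T : topologicalType) (A : set R)
    (f w : R -> R) (z s : T -> R) : compact A ->
  {within A, continuous f} -> {within A, continuous w} ->
  continuous z -> continuous s ->
  closed [set p | exists t, [/\ A t, f t = z p & s p <= w t]].
Proof.
move=> /compact_near_coveringP/near_covering_withinP cA.
move=> /subspace_continuousP cf /subspace_continuousP cw cz cs.
rewrite -[X in closed X]setCK; apply: open_closedC.
rewrite openE => p /= Np; rewrite /interior.
have : \forall q \near p, A `<=` fun t => f t = z q -> w t < s q.
  apply: cA => t At.
  suff : \forall x \near within A (nbhs t) & q \near p, f x = z q -> w x < s q.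
    move=> [[U V] /= [nU nV] UV].
    exists ([set x | A x -> U x], V) => //= -[x q] /= [AU Vq] Ax.
    by apply: (UV (x, q)); split => //; exact: AU.
  have cvg1 (g : R -> R) (h : T -> R) : g @ within A (nbhs t) --> g t ->
      {for p, continuous h} ->
      (fun xq => g xq.1 - h xq.2) @ filter_prod (within A (nbhs t)) (nbhs p)
        --> g t - h p.
    move=> cg ch; apply: cvgB; first exact: (@cvg_comp _ _ _ fst g _ _ _ cvg_fst cg).
    exact: (@cvg_comp _ _ _ snd h _ _ _ cvg_snd ch).
  (* A pair [(t, p)] is excluded either by [w t < s p] or by [f t <> z p]; both conditions persist
     nearby. *)
  have [ftz|ftz] := eqVneq (f t) (z p).
    have wts : w t < s p.
      by rewrite ltNge; apply/negP => swt; apply: Np; exists t.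
    have /(_ _ 0) := cvgr_lt _ (cvg1 w s (cw _ At) (cs p)).
    rewrite subr_lt0 => /(_ wts).
    by apply: filterS => -[x q] /=; rewrite subr_lt0.
  have /(_ _) := cvgr_neq0 _ (cvg1 f z (cf _ At) (cz p)).
  rewrite subr_eq0 => /(_ ftz).
  by apply: filterS => -[x q] /= + fz; rewrite fz subrr eqxx.
apply: filterS => q /= Aq [t [At fz]]; apply/negP; rewrite -ltNge.
exact: Aq.
Qed.

Lemma is_derive_approx (R : realType) (f : R -> R) (x l e : R) :
  is_derive x 1 f l -> 0 < e ->
  \forall y \near x, `|f y - f x - l * (y - x)| <= e * `|y - x|.
Proof.
move=> [df dfl] e0.
have /cvgrPdist_le/(_ _ e0) H :
    h^-1 *: ((f \o shift x) (h *: 1) - f x) @[h --> 0^'] --> l.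
  by rewrite -dfl; exact: df.
have S : (fun y : R => y - x) @ x --> (0 : R).
  by rewrite -(subrr x); apply: cvgB; [exact: cvg_id|exact: cvg_cst].
have {}H : \forall y \near x, y - x != 0 ->
    `|l - (y - x)^-1 *: ((f \o shift x) ((y - x) *: 1) - f x)| <= e := S _ H.
apply: filterS H => y /=; have [->|yx] := eqVneq y x.
  by rewrite !subrr mulr0 subr0 normr0 mulr0.
rewrite subr_eq0 => /(_ yx) /=; rewrite [_ *: 1]mulr1 subrK.
have yx0 : 0 < `|y - x| by rewrite normr_gt0 subr_eq0.
rewrite -(ler_pM2r yx0) -normrM -normrN /GRing.scale/=.
by congr (`|_| <= _); field; rewrite subr_eq0.
Qed.

Lemma polar_coordinates (R : realType) (x y rho : R) :
  0 <= rho -> x ^+ 2 + y ^+ 2 = rho ^+ 2 ->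
  exists2 phi, 0 <= phi < 2 * pi & x = rho * cos phi /\ y = rho * sin phi.
Proof.
move=> rho0 xy; have [rho00|rhoN0] := eqVneq rho 0.
  exists 0; first by rewrite lexx mulr_gt0// pi_gt0.
  rewrite rho00 !mul0r; have : x ^+ 2 + y ^+ 2 = 0 by rewrite xy rho00 expr0n.
  by move/eqP; rewrite paddr_eq0 ?sqr_ge0// !sqrf_eq0 => /andP[/eqP-> /eqP->].
have rho_gt0 : 0 < rho by rewrite lt_neqAle eq_sym rhoN0.
pose c := x / rho; have c_abs : -1 <= c <= 1.
  rewrite -ler_norml -(ler_pXn2r (_ : (0 < 2)%N)) ?nnegrE// expr1n real_normK ?num_real//.
  by rewrite /c expr_div_n ler_pdivrMr ?exprn_gt0// mul1r -xy lerDl sqr_ge0.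
have y2 : (y / rho) ^+ 2 = 1 - c ^+ 2.
  by rewrite /c !expr_div_n -xy; field; rewrite xy expf_neq0.
have ac0 := acos_ge0 c_abs; have acpi := acos_lepi c_abs.
have xc : x = rho * cos (acos c) by rewrite acosK// /c mulrC divfK.
have [y0|y0] := leP 0 y.
  exists (acos c); first by rewrite ac0/= (le_lt_trans acpi)// ltr_pMl ?pi_gt0// ltr1n.
  split=> //; rewrite sin_acos// -y2 sqrtr_sqr ger0_norm ?divr_ge0//.
  by rewrite mulrC divfK.
(* Needed for [2 pi - acos c < 2 pi]: if [c = 1] then [y = 0], contrary to [y < 0]. *)
have ac_gt0 : 0 < acos c.
  apply: acos_gt0; case/andP: c_abs => -> /=; rewrite le_eqVlt => /predU1P[c1|//].
  move/eqP: y2; rewrite c1 expr1n subrr sqrf_eq0 mulf_eq0 invr_eq0 (negbTE rhoN0).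
  by rewrite orbF lt_eqF.
exists (2 * pi - acos c).
  rewrite subr_ge0 ltrBlDr ltrDl ac_gt0 andbT (le_trans acpi)// ler_peMl ?ler1n//.
  exact: pi_ge0.
rewrite mulr_natl cosB sinB cos2pi sin2pi !mul0r addr0 mul1r add0r mul1r -xc; split=> //.
rewrite sin_acos// -y2 sqrtr_sqr ltr0_norm ?pmulr_llt0 ?invr_gt0//.
by rewrite opprK mulrC divfK.
Qed.

(** Serves for points and for vectors: as a vector, [rho] is the component along the radial
    direction at angle [phi], possibly negative, and [z] the axial one. *)
Definition cyl (R : realType) (rho phi z : R) : 'rV[R]_3 :=
  \row_k nth 0 [:: rho * cos phi; rho * sin phi; z] k.

Section cylindrical_coordinates.
Context (R : realType).
Implicit Types (rho phi z : R).

Lemma cyl0 rho phi z : cyl rho phi z 0 0 = rho * cos phi.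
Proof. by rewrite mxE. Qed.

Lemma cyl1 rho phi z : cyl rho phi z 0 1 = rho * sin phi.
Proof. by rewrite mxE. Qed.

Lemma cyl2 rho phi z : cyl rho phi z 0 2 = z.
Proof. by rewrite mxE. Qed.

Lemma row3P (u v : 'rV[R]_3) :
  u 0 0 = v 0 0 -> u 0 1 = v 0 1 -> u 0 2 = v 0 2 -> u = v.
Proof.
move=> uv0 uv1 uv2; apply/rowP => -[[|[|[|//]]] i].
- by rewrite (_ : Ordinal i = 0)//; exact: val_inj.
- by rewrite (_ : Ordinal i = 1)//; exact: val_inj.
- by rewrite (_ : Ordinal i = 2)//; exact: val_inj.
Qed.

Lemma cylD rho rho' phi z z' a :
  cyl rho phi z + a *: cyl rho' phi z' = cyl (rho + a * rho') phi (z + a * z').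
Proof. by apply: row3P; rewrite !mxE/=; ring. Qed.

Lemma dot_cyl rho rho' phi z z' :
  dot (cyl rho phi z) (cyl rho' phi z') = rho * rho' + z * z'.
Proof.
rewrite /dot !big_ord_recl big_ord0 !mxE/=.
rewrite -[rho * rho']mulr1 -(cos2Dsin2 phi); ring.
Qed.

Definition sqr_radius (p : 'rV[R]_3) : R := p 0 0 ^+ 2 + p 0 1 ^+ 2.

Lemma sqr_radius_cyl rho phi z : sqr_radius (cyl rho phi z) = rho ^+ 2.
Proof.
rewrite /sqr_radius cyl0 cyl1 -[RHS]mulr1 -(cos2Dsin2 phi); ring.
Qed.

Lemma sqr_radius_continuous : continuous sqr_radius.
Proof.
move=> p; have c i : (fun p : 'rV[R]_3 => p 0 i) @ p --> p 0 i.
  exact: coord_continuous.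
have -> : sqr_radius = fun p => p 0 0 * p 0 0 + p 0 1 * p 0 1.
  by apply/funext => q; rewrite /sqr_radius !expr2.
exact: (cvgD (cvgM (c 0) (c 0)) (cvgM (c 1) (c 1))).
Qed.

Lemma norm_coord (p : 'rV[R]_3) k : `|p 0 k| <= `|p|.
Proof.
rewrite [leRHS]/Num.Def.normr/= mx_normrE.
by apply/bigmax_geP; right => /=; exists (0, k).
Qed.

Lemma norm_le3 (p : 'rV[R]_3) M : 0 <= M ->
  `|p 0 0| <= M -> `|p 0 1| <= M -> `|p 0 2| <= M -> `|p| <= M.
Proof.
move=> M0 p0 p1 p2; rewrite [leLHS]/Num.Def.normr/= mx_normrE.
rewrite (bigmax_le _ M0)//= => -[i [[|[|[|//]]] ik]] _ /=; rewrite (ord1 i).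
- by rewrite (_ : Ordinal ik = 0)//; exact: val_inj.
- by rewrite (_ : Ordinal ik = 1)//; exact: val_inj.
- by rewrite (_ : Ordinal ik = 2)//; exact: val_inj.
Qed.

Lemma cyl_continuous phi z : continuous (fun rho => cyl rho phi z).
Proof.
have -> : (fun rho => cyl rho phi z) =
          fun rho => cyl 0 phi z + (rho - 0) *: cyl 1 phi 0.
  by apply/funext => rho; rewrite cylD subr0 mulr1 add0r mulr0 addr0.
exact: continuous_line.
Qed.

End cylindrical_coordinates.

Definition surface_of_revolution (R : realType) (eta xi : R -> R)
  (u : 'rV[R]_2) : 'rV[R]_3 := cyl (eta (u 0 0)) (u 0 1) (xi (u 0 0)).

Section solid_of_revolution.
Context (R : realType) (eta xi : R -> R).
Hypotheses (eta_cont : {within `[0, pi], continuous eta})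
  (xi_cont : {within `[0, pi], continuous xi})
  (eta_0 : eta 0 = 0) (eta_pi : eta pi = 0)
  (eta_ge0 : forall th : R, 0 <= eta th)
  (xi_ndecr : forall a b : R, 0 <= a -> a <= b -> b <= pi -> xi a <= xi b).

Let S := surface_of_revolution eta xi @` @sphere R.

(* The closed sets [solid] and [cosolid] cover the space and meet only in the
   surface, so a component of its complement lies in one of them. *)
Definition solid : set 'rV[R]_3 :=
  [set p : 'rV[R]_3 | exists th : R, [/\ [set` `[0, pi]] th, xi th = p 0 2 &
                          sqr_radius p <= eta th ^+ 2]].

Definition cosolid : set 'rV[R]_3 :=
  [set p : 'rV[R]_3 | exists th : R, [/\ [set` `[0, pi]] th, xi th = p 0 2 &
                          - sqr_radius p <= - eta th ^+ 2]]
  `|` [set p : 'rV[R]_3 | p 0 2 <= xi 0]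
  `|` [set p : 'rV[R]_3 | xi pi <= p 0 2].

Let eta2_cont : {within `[0, pi], continuous (fun th => eta th ^+ 2)}.
Proof.
apply: (@within_continuous_comp _ _ _ _ eta (fun x => x ^+ 2)) => // x _.
exact: exprn_continuous.
Qed.

Lemma solid_closed : closed solid.
Proof.
apply: closed_fiber => //; first exact: segment_compact.
- exact: coord_continuous.
- exact: sqr_radius_continuous.
Qed.

Lemma cosolid_closed : closed cosolid.
Proof.
apply: closedU; first apply: closedU.
(* The radius inequality of [cosolid] is written with both sides negated to have the shape required
   by [closed_fiber]. *)
- apply: (@closed_fiber R _ _ xi (fun th => - eta th ^+ 2) (fun p : 'rV[R]_3 => p 0 2)
           (fun p => - sqr_radius p)) => //.
  + exact: segment_compact.
  + apply: (@within_continuous_comp _ _ _ _ eta (fun x => - x ^+ 2)) => // x _.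
    exact: (cvgN (@exprn_continuous R 2 x)).
  + exact: coord_continuous.
  + move=> x; apply: (@continuous_comp _ _ _ (@sqr_radius R) -%R).
      exact: sqr_radius_continuous.
    exact: opp_continuous.
- apply: (@closed_comp _ _ (fun p : 'rV[R]_3 => p 0 2) [set x | x <= xi 0]).
    by move=> ? _; exact: coord_continuous.
  exact: closed_le.
- apply: (@closed_comp _ _ (fun p : 'rV[R]_3 => p 0 2) [set x | xi pi <= x]).
    by move=> ? _; exact: coord_continuous.
  exact: closed_ge.
Qed.

(** Heights outside the open range of [xi] belong to the half-spaces of [cosolid]; at any other
    height the intermediate value theorem gives a parameter [th], and the radius is compared with
    [eta th]. *)
Lemma solid_or_cosolid p : solid p \/ cosolid p.
Proof.
have [?|p0] := leP (p 0 2) (xi 0); first by right; left; right.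
have [?|p1] := leP (xi pi) (p 0 2); first by right; right.
have [|th th_pi xip] := IVT (@pi_ge0 R) xi_cont (v := p 0 2).
  by rewrite ge_min le_max (ltW p0) (ltW p1) orbT.
have [?|?] := leP (sqr_radius p) (eta th ^+ 2).
  by left; exists th.
by right; left; left; exists th; split => //; rewrite lerN2 ltW.
Qed.

(** [xi] may be constant on an interval, so a height can have several parameters. Between [a] and
    [b] it is constant by monotonicity, while [eta ^+ 2] takes there every intermediate value, in
    particular the squared radius of [p]. *)
Lemma solid_sub_level (a b : R) (p : 'rV[R]_3) : 0 <= a <= pi -> 0 <= b <= pi ->
  xi a = p 0 2 -> xi b = p 0 2 ->
  eta a ^+ 2 <= sqr_radius p -> sqr_radius p <= eta b ^+ 2 -> S p.
Proof.
move=> api bpi xia xib rap rbp.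
have [c [c_pi xic etac]] :
    exists c, [/\ 0 <= c <= pi, xi c = p 0 2 & eta c ^+ 2 = sqr_radius p].
  have W (x y : R) : x <= y -> 0 <= x <= pi -> 0 <= y <= pi -> xi x = xi y ->
      Num.min (eta x ^+ 2) (eta y ^+ 2) <= sqr_radius p
        <= Num.max (eta x ^+ 2) (eta y ^+ 2) ->
      exists c, [/\ 0 <= c <= pi, xi c = xi x & eta c ^+ 2 = sqr_radius p].
    move=> xy /andP[x0 xpi] /andP[y0 ypi] xixy v.
    have cont : {within `[x, y], continuous (fun th => eta th ^+ 2)}.
      apply: continuous_subspaceW eta2_cont => t /=.
      by rewrite !in_itv/= => /andP[? ?]; rewrite (le_trans x0)// (le_trans _ ypi).
    have [c] := IVT xy cont v; rewrite in_itv/= => /andP[xc cy] ?.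
    have c0 := le_trans x0 xc; have cpi := le_trans cy ypi.
    exists c; split=> //; first by rewrite c0.
    by apply/eqP; rewrite eq_le {1}xixy !xi_ndecr.
  have [ab|/ltW ba] := leP a b.
    rewrite -xia; apply: (W a b) => //; first by rewrite xia.
    by rewrite ge_min le_max rap rbp orbT.
  rewrite -xib; apply: (W b a) => //; first by rewrite xib.
  by rewrite ge_min le_max rap rbp orbT.
have [phi phi_pi [p0 p1]] := polar_coordinates (eta_ge0 c) (esym etac).
exists (pt c phi); first by rewrite /sphere/= pt0 pt1.
by rewrite /surface_of_revolution pt0 pt1; apply: row3P; rewrite ?cyl0 ?cyl1 ?cyl2.
Qed.

Lemma solid_cosolid p : solid p -> cosolid p -> S p.
Proof.
have sq0 : 0 <= sqr_radius p by rewrite addr_ge0 ?sqr_ge0.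
move=> [b [/=]]; rewrite in_itv/= => bpi xib rb.
have [b0 b1] := andP bpi.
move=> [[[a [/=]]|/= z0]|/= z1].
- rewrite in_itv/= lerN2 => api xia ra; exact: (solid_sub_level api bpi).
(* By monotonicity the height is exactly [xi 0], and the pole, where [eta = 0], provides the smaller
   radius. *)
- apply: (@solid_sub_level 0 b) => //; first by rewrite lexx pi_ge0.
    by apply/eqP; rewrite eq_le z0 andbT -xib xi_ndecr.
  by rewrite eta_0 expr0n.
- apply: (@solid_sub_level pi b) => //; first by rewrite lexx pi_ge0.
    by apply/eqP; rewrite eq_le z1 /= -xib xi_ndecr.
  by rewrite eta_pi expr0n.
Qed.

Lemma surface_sub_solid p : S p -> solid p.
Proof.
move=> [u [u_pi _] <-]; exists (u 0 0); split => /=.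
- by rewrite in_itv.
- by rewrite cyl2.
- by rewrite sqr_radius_cyl.
Qed.

Lemma solid_bounded : bounded_set solid.
Proof.
have [c _ eta_max] := EVT_max (@pi_ge0 R) eta_cont.
(* The maximum of [eta] bounds the horizontal coordinates, and the other two terms bound the height,
   which lies between [xi 0] and [xi pi]. *)
pose M := eta c + `|xi 0| + `|xi pi|.
exists M; split; first exact: num_real.
move=> y /ltW My p [th [th_pi xith rp]] /=; apply: le_trans My.
have [th0 th1] : 0 <= th /\ th <= pi.
  by move: th_pi; rewrite /= in_itv/= => /andP.
have M0 : 0 <= M by rewrite !addr_ge0.
have le_eta x : x ^+ 2 <= sqr_radius p -> `|x| <= M.
  move=> xp; apply: (@le_trans _ _ (eta th)).
    by rewrite -(ler_pXn2r (_ : (0 < 2)%N)) ?nnegrE// real_normK ?num_real// (le_trans xp).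
  by rewrite (le_trans (eta_max th _)) ?in_itv ?th0// /M -addrA lerDl addr_ge0.
apply: norm_le3 => //.
- by apply: le_eta; rewrite lerDl sqr_ge0.
- by apply: le_eta; rewrite lerDr sqr_ge0.
- have x0 := xi_ndecr (lexx 0) th0 th1; have x1 := xi_ndecr th0 th1 (lexx pi).
  have e0 := eta_ge0 c; have := ler_norm (xi pi).
  have := ler_norm (- xi 0); rewrite normrN => y0 y1.
  have a0 := normr_ge0 (xi 0); have a1 := normr_ge0 (xi pi).
  rewrite -xith ler_norml /M; apply/andP; split; lra.
Qed.

Lemma solid_not_exterior p : solid p -> ~ exterior S p.
Proof.
move=> solidp [NSp]; apply; set C := connected_component (~` S) p.
have CS : C `<=` ~` S by exact: connected_component_sub.
(* Within the component, [solid] is relatively closed, and relatively open because it coincides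
   there with the complement of [cosolid]. *)
have solidC : C `&` solid = C.
  apply: (@component_connected _ (~` S) p) => //.
  - by exists p; split => //; exact: connected_component_refl.
  - exists (~` cosolid); first by apply: closed_openC; exact: cosolid_closed.
    apply/seteqP; split=> q [Cq].
      by move=> solidq; split=> // cosolidq; exact: (CS _ Cq (solid_cosolid solidq cosolidq)).
    by move=> Ncq; split=> //; have [//|/Ncq] := solid_or_cosolid q.
  - by exists solid => //; exact: solid_closed.
have [M [Mreal HM]] := solid_bounded.
exists M; split=> // x Mx q Cq; apply: (HM x Mx).
by have [_] : (C `&` solid) q by rewrite solidC.
Qed.

Lemma not_solid_exterior rho phi z : 0 <= rho ->
  ~ solid (cyl rho phi z) -> exterior S (cyl rho phi z).
Proof.
move=> rho0 Nsolid; split; first by move/surface_sub_solid.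
pose ray := (fun t => cyl t phi z) @` [set` `[rho, +oo[].
have rayS : ray `<=` ~` S.
  move=> _ [t + <-]; rewrite /= in_itv/= andbT => rhot /surface_sub_solid.
  move=> [th [th_pi xith]]; rewrite sqr_radius_cyl => t_eta; apply: Nsolid.
  exists th; split=> //; first by rewrite xith !cyl2.
  by rewrite sqr_radius_cyl (le_trans _ t_eta)// ler_pXn2r// nnegrE (le_trans rho0).
have ray_connected : connected ray.
  apply: connected_continuous_connected.
    by apply/connected_intervalP; exact: interval_is_interval.
  by apply: continuous_subspaceT => t; exact: cyl_continuous.
have rayC : ray `<=` connected_component (~` S) (cyl rho phi z).
  apply: connected_component_max => //.
  by exists rho => //=; rewrite in_itv/= lexx.
move=> [M [_ HM]]; pose N := `|M| + 1.
have MN : M < N by rewrite ltr_pwDr// ler_norm.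
have N0 : 0 < N by rewrite ltr_wpDl.
(* At this radius [t ^+ 2 >= 4 * N ^+ 2], whereas coordinates bounded by [N] would give
   [t ^+ 2 <= 2 * N ^+ 2]. *)
pose t := rho + 2 * N.
have t0 : 0 <= t by rewrite addr_ge0// mulr_ge0 ?ltW.
have tray : ray (cyl t phi z).
  by exists t => //=; rewrite in_itv/= andbT lerDl mulr_ge0 ?ltW.
have normt : `|cyl t phi z| <= N by exact: HM N MN _ (rayC _ tray).
have sq k : cyl t phi z 0 k ^+ 2 <= N ^+ 2.
  rewrite -[leLHS]real_normK ?num_real//.
  by rewrite ler_pXn2r ?nnegrE ?(ltW N0)// (le_trans (norm_coord _ _)).
have tN : (2 * N) ^+ 2 <= t ^+ 2.
  by rewrite ler_pXn2r ?nnegrE ?mulr_ge0 ?(ltW N0)// lerDr.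
have N2 : 0 < N ^+ 2 by rewrite exprn_gt0.
have := lerD (sq 0) (sq 1); rewrite -/(sqr_radius _) sqr_radius_cyl => tN'.
have := le_trans tN tN'; rewrite exprMn; lra.
Qed.

End solid_of_revolution.

(** * The outward normal and the embedded mean curvature *)

Section outward_normal.
Context (R : realType) (eta xi : R -> R).
Hypotheses (eta_cont : {within `[0, pi], continuous eta})
  (xi_cont : {within `[0, pi], continuous xi})
  (eta_0 : eta 0 = 0) (eta_pi : eta pi = 0)
  (eta_ge0 : forall th : R, 0 <= eta th)
  (xi_ndecr : forall a b : R, 0 <= a -> a <= b -> b <= pi -> xi a <= xi b).

Let S := surface_of_revolution eta xi @` @sphere R.

(** In (radial, axial) components the profile has velocity [s (n, m)] at [th0], with [(n, m)] a unit
    vector; [(m, - n)] is then a unit normal. *)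
Variables (th0 s m n : R).
Hypotheses (th0_pi : 0 < th0 < pi) (eta_gt0 : 0 < eta th0)
  (s0 : 0 < s) (m0 : 0 < m) (mn : m ^+ 2 + n ^+ 2 = 1)
  (eta_d : is_derive th0 1 eta (s * n)) (xi_d : is_derive th0 1 xi (s * m)).

(* [m (eta - eta th0) - n (xi - xi th0)] is the height over the tangent line of
   the profile curve: it is of order [o(th - th0)]. *)
Let profile_approx : exists d : R, [/\ 0 < d, 0 <= th0 - d, th0 + d <= pi &
  forall th, `|th - th0| <= d ->
    `|m * (eta th - eta th0) - n * (xi th - xi th0)|
      <= s * m / 4 * `|th - th0| /\
    `|xi th - xi th0 - s * m * (th - th0)| <= s * m / 2 * `|th - th0|].
Proof.
have sm0 : 0 < s * m by rewrite mulr_gt0.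
have L_d : is_derive th0 1 (fun th => m * eta th - n * xi th) 0.
  have : is_derive th0 1 (m \*: eta - n \*: xi) (m *: (s * n) - n *: (s * m)).
    by exact: is_deriveB.
  rewrite [X in is_derive _ _ _ X](_ : _ = 0) //.
  by rewrite /GRing.scale/=; ring.
(* With these tolerances, [|xi th - xi th0| <= e] forces [s * m * |th - th0| <= 2 * e], and the
   height over the tangent line is then at most [e / 2]. *)
have sm4 : 0 < s * m / 4 by rewrite divr_gt0.
have sm2 : 0 < s * m / 2 by rewrite divr_gt0.
have [d1 /= d1_gt0 H1] := is_derive_approx L_d sm4.
have [d2 /= d2_gt0 H2] := is_derive_approx xi_d sm2.
case/andP: th0_pi => th0_gt0 th0_ltpi.
(* Halving makes [d < d1] and [d < d2] strict; the other two terms keep [th0 - d] and [th0 + d] in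
   [[0, pi]]. *)
pose d := Num.min (Num.min (d1 / 2) (d2 / 2)) (Num.min th0 (pi - th0)).
have d0 : 0 < d by rewrite !lt_min !divr_gt0//= th0_gt0 subr_gt0.
have dd1 : d < d1.
  by rewrite !gt_min (_ : d1 / 2 < d1)//; lra.
have dd2 : d < d2.
  by rewrite !gt_min (_ : d2 / 2 < d2) ?orbT//; lra.
exists d; split => //.
- by rewrite subr_ge0 !ge_min lexx !orbT.
- by rewrite -lerBrDl !ge_min lexx !orbT.
move=> th thd; split.
  have := H1 th; rewrite /ball_/= distrC => /(_ (le_lt_trans thd dd1)).
  rewrite mul0r subr0; congr (`|_| <= _); ring.
by apply: H2; rewrite /ball_/= distrC (le_lt_trans thd dd2).
Qed.

(** Monotonicity of [xi] confines the parameters at a displaced height to [|th - th0| <= d], where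
    first-order estimates decide the comparison of radii. One half makes the candidate normal
    outward, the other excludes its opposite. *)
Lemma profile_sides phi : \forall e \near 0^'+,
  ~ solid eta xi (cyl (eta th0 + e * m) phi (xi th0 - e * n)) /\
  solid eta xi (cyl (eta th0 - e * m) phi (xi th0 + e * n)).
Proof.
have [d [d0 th0d0 th0dpi approx]] := profile_approx.
have sm0 : 0 < s * m by rewrite mulr_gt0.
have n2 : 0 <= n ^+ 2 by exact: sqr_ge0.
have m2 : 0 <= m ^+ 2 by exact: sqr_ge0.
have n1 : `|n| <= 1.
  rewrite -(ler_pXn2r (_ : (0 < 2)%N)) ?nnegrE// real_normK ?num_real//.
  by rewrite expr1n -mn lerDr.
have m1 : m <= 1.
  rewrite -(ler_pXn2r (_ : (0 < 2)%N)) ?nnegrE// ?(ltW m0)//.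
  by rewrite expr1n -mn lerDl.
have dR : `|th0 + d - th0| = d by rewrite addrC addKr gtr0_norm.
have dL : `|th0 - d - th0| = d by rewrite addrAC subrr sub0r normrN gtr0_norm.
have xi_right : xi th0 + s * m * d / 2 <= xi (th0 + d).
  have [|_] := approx (th0 + d); rewrite dR// ler_norml => /andP[+ _].
  by rewrite (addrC th0) addrK; lra.
have xi_left : xi (th0 - d) <= xi th0 - s * m * d / 2.
  have [|_] := approx (th0 - d); rewrite dL// ler_norml => /andP[_].
  by rewrite (addrC th0) addrK; lra.
have th0Rpi : 0 <= th0 + d <= pi by rewrite th0dpi andbT; lra.
have th0Lpi : 0 <= th0 - d <= pi by rewrite th0d0; lra.
near=> e.
have e0 : 0 < e by near: e; exact: nbhs_right_gt.
(* Keeps the displaced heights strictly between [xi (th0 - d)] and [xi (th0 + d)]. The next bound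
   keeps the radius [eta th0 - e * m] nonnegative, so that radii can be compared through their
   squares. *)
have e_small : e < s * m * d / 2.
  by near: e; apply: nbhs_right_lt; rewrite divr_gt0// mulr_gt0.
have e_eta : e < eta th0 by near: e; exact: nbhs_right_lt.
have en : `|e * n| <= e by rewrite normrM gtr0_norm// ler_piMr// ltW.
have /andP[en1 en2] : - e <= e * n <= e by rewrite -ler_norml.
have em : e * m <= e by rewrite ler_piMr// ltW.
have em0 : 0 < e * m by rewrite mulr_gt0.
(* The displaced points have axial offset at most [e]; at their height the
   profile is within [e / 2] of its tangent line, whereas they are at distance
   [e] from it. *)
have tangent_bound th : `|th - th0| <= d -> `|xi th - xi th0| = `|e * n| ->
    `|m * (eta th - eta th0) - n * (xi th - xi th0)| <= e / 2.
  move=> /approx[L X] xie.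
  have : s * m * `|th - th0| <= 2 * e.
    have : `|s * m * (th - th0)| <= `|xi th - xi th0| + s * m / 2 * `|th - th0|.
      rewrite -[X in `|X| <= _](subKr (xi th - xi th0)).
      by rewrite (le_trans (ler_normB _ _))// lerD2l.
    by rewrite normrM (gtr0_norm sm0) xie; lra.
  lra.
split.
  move=> [th [/=]]; rewrite in_itv/= cyl2 sqr_radius_cyl => /andP[th_ge0 th_lepi].
  move=> xith; rewrite ler_pXn2r ?nnegrE ?addr_ge0 ?(ltW em0)// => etath.
  have thd : `|th - th0| <= d.
    rewrite ler_norml; apply/andP; split; rewrite leNgt; apply/negP => thd.
      have : xi th <= xi (th0 - d).
        by apply: xi_ndecr => //; lra.
      by lra.
    have : xi (th0 + d) <= xi th.
      by apply: xi_ndecr => //; lra.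
    by lra.
  have := tangent_bound th thd; rewrite xith addrAC subrr sub0r normrN.
  move=> /(_ erefl); rewrite ler_norml => /andP[_].
  (* The height over the tangent line would be at least [e * m ^+ 2 + e * n ^+ 2 = e], above the
     bound [e / 2]. *)
  have : m * (eta th - eta th0) >= m * (e * m) by rewrite ler_pM2l//; lra.
  have : e * (m ^+ 2 + n ^+ 2) = e by rewrite mn mulr1.
  lra.
have th0LR : th0 - d <= th0 + d by lra.
have xi_contLR : {within `[th0 - d, th0 + d], continuous xi}.
  apply: continuous_subspaceW xi_cont => t /=.
  by rewrite !in_itv/= => /andP[? ?]; apply/andP; lra.
have [|th thL xith] := IVT th0LR xi_contLR (v := xi th0 + e * n).
  by rewrite ge_min le_max; apply/andP; split; apply/orP; [left|right]; lra.
move: thL; rewrite in_itv/= => /andP[thL thR].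
exists th; split => /=.
- by rewrite in_itv/=; apply/andP; lra.
- by rewrite cyl2.
- have etam0 : 0 <= eta th0 - e * m by lra.
  rewrite sqr_radius_cyl ler_pXn2r ?nnegrE//.
  have thd : `|th - th0| <= d by rewrite ler_norml; apply/andP; lra.
  have := tangent_bound th thd; rewrite xith addrAC subrr add0r.
  move=> /(_ erefl); rewrite ler_norml => /andP[+ _].
  have : e * (m ^+ 2 + n ^+ 2) = e by rewrite mn mulr1.
  rewrite -(ler_pM2l m0) => *.
  lra.
Unshelve. all: by end_near. Qed.

Let X := surface_of_revolution eta xi.

(** [get] returns some outward unit normal, so uniqueness matters: of the two opposite candidates,
    one leads out of [solid], hence to the exterior, and the other leads into it. *)
Lemma outward_unit_normalE phi :
  (forall N, (forall a, dot (tangent X a (pt th0 phi)) N = 0) ->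
     dot N N = 1 -> N = cyl m phi (- n) \/ N = - cyl m phi (- n)) ->
  (forall a, dot (tangent X a (pt th0 phi)) (cyl m phi (- n)) = 0) ->
  outward_unit_normal S X (pt th0 phi) = cyl m phi (- n).
Proof.
move=> normals ortho; have sides := profile_sides phi.
have XE : X (pt th0 phi) = cyl (eta th0) phi (xi th0).
  by rewrite /X /surface_of_revolution pt0 pt1.
have outward : is_outward_unit_normal S X (pt th0 phi) (cyl m phi (- n)).
  split => //; first by rewrite dot_cyl -mn; ring.
  near=> e; rewrite XE cylD mulrN; apply: not_solid_exterior => //.
    have : 0 < e by near: e; exact: nbhs_right_gt.
    by move=> e0; rewrite addr_ge0// mulr_ge0// ltW.
  by have [] : ~ solid eta xi (cyl (eta th0 + e * m) phi (xi th0 - e * n)) /\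
     solid eta xi (cyl (eta th0 - e * m) phi (xi th0 + e * n)) by near: e.
rewrite /outward_unit_normal.
have [Nunit Northo Nout] := getPex (ex_intro _ _ outward).
have [//|NE] := normals _ Northo Nunit.
exfalso; near (0 : R)^'+ => e.
have : exterior S (X (pt th0 phi) + e *: - cyl m phi (- n)).
  by rewrite -NE; near: e.
rewrite XE scalerN -scaleNr cylD mulNr mulrNN; apply: solid_not_exterior => //.
by have [] : ~ solid eta xi (cyl (eta th0 + e * m) phi (xi th0 - e * n)) /\
   solid eta xi (cyl (eta th0 - e * m) phi (xi th0 + e * n)) by near: e.
Unshelve. all: by end_near. Qed.

End outward_normal.

(** * Tangent vectors and mean curvature of a surface of revolution *)

Lemma chart_near (R : realType) (u : 'rV[R]_2) : chart u ->
  \forall v \near u, chart v.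
Proof.
rewrite /chart/= => /andP[u0 upi]; near=> v; apply/andP; split.
- by near: v; apply: (cvgr_gt (u 0 0)) => //; exact: coord_continuous.
- by near: v; apply: (cvgr_lt (u 0 0)) => //; exact: coord_continuous.
Unshelve. all: by end_near. Qed.

(* [rev_map c f g] is the surface of revolution with profile [(f, g)], turned
   by the angle [c]; such maps are closed under partial differentiation. *)
Definition rev_map (R : realType) (c : R) (f g : R -> R) (u : 'rV[R]_2) :
  'rV[R]_3 := cyl (f (u 0 0)) (u 0 1 + c) (g (u 0 0)).

Section tangents.
Context (R : realType).
Implicit Types (f g : R -> R) (a b c rho phi z : R).

Lemma surface_of_revolutionE f g : surface_of_revolution f g = rev_map 0 f g.
Proof. by apply/funext => u; rewrite /rev_map addr0. Qed.

(** The formula for [tangent X 0] is available over the chart only, so second derivatives are taken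
    from an equality valid near the point. *)
Lemma tangent_near (X Y : 'rV[R]_2 -> 'rV[R]_3) (a : 'I_2) (u : 'rV[R]_2) :
  (\forall v \near u, X v = Y v) -> tangent X a u = tangent Y a u.
Proof.
move=> XY; apply/rowP => k; rewrite !mxE; apply: near_eq_derive.
by apply: filterS XY => v ->.
Qed.

Lemma tangent0_rev f g a b c : derivable f a 1 -> derivable g a 1 ->
  tangent (rev_map c f g) 0 (pt a b) = cyl (derive1 f a) (b + c) (derive1 g a).
Proof.
move=> df dg.
have tk k : tangent (rev_map c f g) 0 (pt a b) 0 k =
    'D_1 (fun t : R => cyl (f t) (b + c) (g t) 0 k) a.
  rewrite [LHS]mxE partial0E (pt0 a b) (pt1 a b).
  suff -> : (fun t : R => rev_map c f g (pt t b) 0 k) =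
            (fun t : R => cyl (f t) (b + c) (g t) 0 k) by [].
  by apply/funext => t; rewrite /rev_map pt0 pt1.
apply: row3P; rewrite tk !mxE/=; under eq_fun do rewrite mxE/=.
- by rewrite (deriveMr _ df) derive1E mulrC.
- by rewrite (deriveMr _ df) derive1E mulrC.
- by rewrite derive1E.
Qed.

(** Differentiating [cos] and [sin] amounts to a shift by [pi / 2], so a [phi]-derivative is a
    quarter turn that removes the axial component. *)
Lemma tangent1_rev f g a b c :
  tangent (rev_map c f g) 1 (pt a b) = cyl (f a) (b + (c + pi / 2)) 0.
Proof.
have tk k : tangent (rev_map c f g) 1 (pt a b) 0 k =
    'D_1 (fun t : R => cyl (f a) (t + c) (g a) 0 k) b.
  rewrite [LHS]mxE partial1E (pt0 a b) (pt1 a b).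
  suff -> : (fun t : R => rev_map c f g (pt a t) 0 k) =
            (fun t : R => cyl (f a) (t + c) (g a) 0 k) by [].
  by apply/funext => t; rewrite /rev_map pt0 pt1.
have shift_d : is_derive b 1 (fun t : R => t + c) 1 by exact: is_derive_shift.
have dcos : is_derive b 1 (fun t : R => cos (t + c)) (- sin (b + c)).
  rewrite -[X in is_derive _ _ _ X]mulr1.
  exact: (@is_derive1_comp R cos (fun t => t + c) b _ _ (is_derive_cos _) shift_d).
have dsin : is_derive b 1 (fun t : R => sin (t + c)) (cos (b + c)).
  rewrite -[X in is_derive _ _ _ X]mulr1.
  exact: (@is_derive1_comp R sin (fun t => t + c) b _ _ (is_derive_sin _) shift_d).
apply: row3P; rewrite tk !mxE/=; under eq_fun do rewrite mxE/=.
- by rewrite (deriveMl _ (@ex_derive _ _ _ _ _ _ _ dcos)) derive_val addrA cosDpihalf.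
- by rewrite (deriveMl _ (@ex_derive _ _ _ _ _ _ _ dsin)) derive_val addrA sinDpihalf.
- by rewrite derive_cst.
Qed.

Lemma dot_cyl_turn rho rho' phi z :
  dot (cyl rho phi z) (cyl rho' (phi + pi / 2) 0) = 0 :> R.
Proof.
rewrite /dot !big_ord_recl big_ord0 !mxE/= cosDpihalf sinDpihalf; ring.
Qed.

Lemma dotC (u v : 'rV[R]_3) : dot u v = dot v u.
Proof. by apply: eq_bigr => k _; rewrite mulrC. Qed.

(** The given vector spans the azimuthal direction; the witnesses are the radial and axial
    components of [N]. *)
Lemma orthogonal_turnP rho phi (N : 'rV[R]_3) : rho != 0 ->
  dot (cyl rho (phi + pi / 2) 0) N = 0 -> exists a b, N = cyl a phi b.
Proof.
move=> rho0; rewrite /dot !big_ord_recl big_ord0 !mxE/= cosDpihalf sinDpihalf.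
rewrite mul0r !addr0 -!mulrA -mulrDr => /eqP.
rewrite mulf_eq0 (negbTE rho0)/= => /eqP.
rewrite (_ : lift ord0 ord0 = 1) 1?[- _ * _]mulrC 1?[cos _ * _]mulrC => [N01|]; last exact: val_inj.
exists (N 0 0 * cos phi + N 0 1 * sin phi), (N 0 2).
have cs := cos2Dsin2 phi; have := N01.
set C := cos phi in cs *; set D := sin phi in cs * => E.
apply: row3P; rewrite ?cyl0 ?cyl1 ?cyl2 // -/C -/D.
- have -> : (N 0 0 * C + N 0 1 * D) * C =
            N 0 0 * (C ^+ 2 + D ^+ 2) + D * (N 0 0 * - D + N 0 1 * C) by ring.
  by rewrite cs E mulr0 addr0 mulr1.
- have -> : (N 0 0 * C + N 0 1 * D) * D =
            N 0 1 * (C ^+ 2 + D ^+ 2) - C * (N 0 0 * - D + N 0 1 * C) by ring.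
  by rewrite cs E mulr0 subr0 mulr1.
Qed.

End tangents.

(** The trace of the shape operator for the normal [(q / s, - p / s)], where [p, q] and [p', q']
    stand for the first and second derivatives of [eta] and [xi]. The right-hand side adds the
    curvatures of the meridian and of the parallel. *)
Lemma curvature_sum (F : fieldType) (p p' q q' e s : F) : s != 0 -> e != 0 ->
  - (p' * (q / s) + q' * - (p / s)) / s ^+ 2
  - (- e * (q / s) + 0 * - (p / s)) / e ^+ 2
  = (q' * p - p' * q) / s ^+ 3 + q / (s * e).
Proof. by move=> s0 e0; field; rewrite s0 e0. Qed.

Section mean_curvature.
Context (R : realType) (eta xi : R -> R).
Hypotheses (eta_cont : {within `[0, pi], continuous eta})
  (xi_cont : {within `[0, pi], continuous xi})
  (eta_0 : eta 0 = 0) (eta_pi : eta pi = 0)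
  (eta_ge0 : forall th : R, 0 <= eta th)
  (eta_gt0 : forall th : R, 0 < th < pi -> 0 < eta th)
  (xi_ndecr : forall a b : R, 0 <= a -> a <= b -> b <= pi -> xi a <= xi b)
  (eta_d : forall th : R, 0 < th < pi -> derivable eta th 1)
  (xi_d : forall th : R, 0 < th < pi -> derivable xi th 1)
  (eta_dd : forall th : R, 0 < th < pi -> derivable (derive1 eta) th 1)
  (xi_dd : forall th : R, 0 < th < pi -> derivable (derive1 xi) th 1)
  (xi'_ge0 : forall th : R, 0 < th < pi -> 0 <= derive1 xi th)
  (s : R -> R) (s_gt0 : forall th : R, 0 < th < pi -> 0 < s th)
  (speed : forall th : R, 0 < th < pi ->
     s th ^+ 2 = derive1 eta th ^+ 2 + derive1 xi th ^+ 2).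

Let X := surface_of_revolution eta xi.
Let S := X @` @sphere R.

Lemma tangent0E th phi : 0 < th < pi ->
  tangent X 0 (pt th phi) = cyl (derive1 eta th) phi (derive1 xi th).
Proof.
move=> th_pi; rewrite /X surface_of_revolutionE tangent0_rev ?addr0//.
- exact: eta_d.
- exact: xi_d.
Qed.

Lemma tangent1E th phi :
  tangent X 1 (pt th phi) = cyl (eta th) (phi + pi / 2) 0.
Proof. by rewrite /X surface_of_revolutionE tangent1_rev add0r. Qed.

Lemma tangent00E th phi : 0 < th < pi ->
  tangent (tangent X 0) 0 (pt th phi) =
  cyl (derive1 (derive1 eta) th) phi (derive1 (derive1 xi) th).
Proof.
move=> th_pi.
rewrite (@tangent_near _ _ (rev_map 0 (derive1 eta) (derive1 xi))).
  by rewrite tangent0_rev ?addr0//; [exact: eta_dd|exact: xi_dd].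
have : chart (pt th phi) by rewrite /chart/= pt0.
move/chart_near; apply: filterS => v; rewrite /chart/= => v_pi.
by rewrite -[v in LHS]pt_coord tangent0E// /rev_map addr0.
Qed.

Lemma tangent11E th phi :
  tangent (tangent X 1) 1 (pt th phi) = cyl (- eta th) phi 0.
Proof.
have -> : tangent X 1 = rev_map (pi / 2) eta (fun=> 0).
  by apply/funext => v; rewrite -[v in LHS]pt_coord tangent1E.
rewrite tangent1_rev; apply: row3P; rewrite !mxE//=.
- by rewrite addrA cosDpihalf sinDpihalf mulrN mulNr.
- by rewrite addrA sinDpihalf cosDpihalf mulrN mulNr.
Qed.

Lemma first_fundamental_formE th phi : 0 < th < pi ->
  first_fundamental_form X (pt th phi) = diag_mx (pt (s th ^+ 2) (eta th ^+ 2)).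
Proof.
move=> th_pi; apply/matrixP => i j; rewrite !mxE.
case: i j => -[|[|//]] ? [[|[|//]]] ? /=; rewrite ?mulr1n ?mulr0n.
- rewrite (_ : Ordinal _ = 0); last exact: val_inj.
  rewrite (_ : Ordinal _ = 0); last exact: val_inj.
  by rewrite tangent0E// dot_cyl speed// !expr2.
- rewrite (_ : Ordinal _ = 0); last exact: val_inj.
  rewrite (_ : Ordinal _ = 1); last exact: val_inj.
  by rewrite tangent0E// tangent1E dot_cyl_turn.
- rewrite (_ : Ordinal _ = 1); last exact: val_inj.
  rewrite (_ : Ordinal _ = 0); last exact: val_inj.
  by rewrite tangent0E// tangent1E dotC dot_cyl_turn.
- rewrite (_ : Ordinal _ = 1); last exact: val_inj.
  rewrite (_ : Ordinal _ = 1); last exact: val_inj.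
  by rewrite tangent1E dot_cyl mulr0 addr0 expr2.
Qed.

(** The first fundamental form is diagonal, so only the pure second derivatives enter the trace. The
    normal stays as chosen by [get], which keeps the formula usable where [xi'] vanishes. *)
Lemma outward_mean_curvature_normal th phi : 0 < th < pi ->
  let N := outward_unit_normal S X (pt th phi) in
  outward_mean_curvature S X (pt th phi) =
  - dot (cyl (derive1 (derive1 eta) th) phi (derive1 (derive1 xi) th)) N
    / s th ^+ 2
  - dot (cyl (- eta th) phi 0) N / eta th ^+ 2.
Proof.
move=> th_pi N; rewrite /outward_mean_curvature first_fundamental_formE//.
have [s_th eta_th] := (s_gt0 th_pi, eta_gt0 th_pi).
rewrite invmx_diag => [|[[|[|//]]] ?]; last 2 first.
- by rewrite mxE/= expf_neq0 ?gt_eqF.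
- by rewrite mxE/= expf_neq0 ?gt_eqF.
rewrite mul_diag_mx /mxtrace !big_ord_recl big_ord0 !mxE/=.
rewrite (_ : lift ord0 ord0 = 1); last exact: val_inj.
rewrite tangent00E// tangent11E -/N addr0.
by congr (_ + _); rewrite mulrC ?mulNr.
Qed.

Lemma profile_normals th phi (N : 'rV[R]_3) : 0 < th < pi ->
  (forall a, dot (tangent X a (pt th phi)) N = 0) ->
  exists a b, N = cyl a phi b /\ derive1 eta th * a + derive1 xi th * b = 0.
Proof.
move=> th_pi ortho; have := ortho 1; rewrite tangent1E.
move=> /orthogonal_turnP[|a [b NE]]; first by rewrite gt_eqF// eta_gt0.
exists a, b; split=> //.
by have := ortho 0; rewrite tangent0E// NE dot_cyl.
Qed.

Lemma outward_mean_curvatureE th phi : 0 < th < pi ->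
  (derive1 xi th = 0 -> derive1 (derive1 xi) th = 0) ->
  outward_mean_curvature S X (pt th phi) =
  (derive1 (derive1 xi) th * derive1 eta th
   - derive1 (derive1 eta) th * derive1 xi th) / s th ^+ 3
  + derive1 xi th / (s th * eta th).
Proof.
move=> th_pi xi''0; rewrite outward_mean_curvature_normal//.
have [s_th eta_th] := (s_gt0 th_pi, eta_gt0 th_pi).
have sp := speed th_pi.
set p := derive1 eta th in sp *; set q := derive1 xi th in sp xi''0 *.
have [q0|q0] := eqVneq q 0.
  rewrite (xi''0 q0) q0 !mul0r !mulr0 subrr mul0r addr0.
  have p0 : p != 0.
    by apply: contraTneq s_th => p0; move/eqP: sp; rewrite q0 p0 expr0n addr0
      sqrf_eq0 => /eqP ->; rewrite ltxx.
  (* An axial vector is orthogonal to both second derivatives, because [xi'' = 0]. Every normal is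
     axial here, and so is the zero vector that [get] returns by default if no outward normal
     exists. *)
  suff [b ->] : exists b, outward_unit_normal S X (pt th phi) = cyl 0 phi b.
    by rewrite !dot_cyl !(mulr0, mul0r, addr0, oppr0, subr0).
  rewrite /outward_unit_normal.
  case: (pselect (exists N, is_outward_unit_normal S X (pt th phi) N)).
    move=> /getPex[_ /(profile_normals th_pi)[a [b [-> +]]] _].
    rewrite -/p -/q q0 mul0r addr0 => /eqP; rewrite mulf_eq0 (negbTE p0)/=.
    by move=> /eqP ->; exists b.
  move=> /forallNP/getPN ->; exists 0.
  by apply/rowP => -[[|[|[|//]]] ?]; rewrite !mxE/= ?mul0r.
have q_gt0 : 0 < q by rewrite lt_neqAle eq_sym q0 xi'_ge0.
have eta_d' : is_derive th 1 eta (s th * (p / s th)).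
  by rewrite mulrC divfK ?gt_eqF// /p derive1E; apply: derivableP; exact: eta_d.
have xi_d' : is_derive th 1 xi (s th * (q / s th)).
  by rewrite mulrC divfK ?gt_eqF// /q derive1E; apply: derivableP; exact: xi_d.
rewrite (@outward_unit_normalE _ eta xi eta_cont xi_cont eta_0 eta_pi eta_ge0
  xi_ndecr th (s th) (q / s th) (p / s th))//.
- by rewrite !dot_cyl curvature_sum ?gt_eqF.
- by rewrite divr_gt0.
- by rewrite !expr_div_n -mulrDl addrC -sp divff// expf_neq0// gt_eqF.
- move=> N /(profile_normals th_pi)[a [b [-> +]]]; rewrite -/p -/q dot_cyl => pq ab1.
  (* Being orthogonal to [(p, q)], the pair [(a, b)] is [w] times the unit vector
     [(q / s, - p / s)]; unit length forces [w = 1] or [w = -1]. *)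
  pose w := (a * q - b * p) / s th.
  have aE : a = w * (q / s th).
    rewrite /w; transitivity (a * (p ^+ 2 + q ^+ 2) / s th ^+ 2 - p * (p * a + q * b) / s th ^+ 2).
      by rewrite -sp pq; field; rewrite gt_eqF.
    by field; rewrite gt_eqF.
  have bE : b = - w * (p / s th).
    rewrite /w; transitivity (b * (p ^+ 2 + q ^+ 2) / s th ^+ 2 - q * (p * a + q * b) / s th ^+ 2).
      by rewrite -sp pq; field; rewrite gt_eqF.
    by field; rewrite gt_eqF.
  have w2 : w ^+ 2 = 1.
    rewrite -ab1 {1 2}aE {1 2}bE.
    transitivity (w ^+ 2 * ((p ^+ 2 + q ^+ 2) / s th ^+ 2)); last first.
      by field; rewrite gt_eqF.
    by rewrite -sp divff ?mulr1// expf_neq0// gt_eqF.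
  move/eqP: w2; rewrite sqrf_eq1 => /orP[/eqP w1|/eqP w1]; [left|right].
    by rewrite aE bE w1 mul1r mulN1r.
  rewrite aE bE w1 opprK mul1r mulN1r; apply: row3P; rewrite !mxE/=; ring.
- move=> a; have [->|a1] : a = 0 \/ a = 1.
    by case: a => -[|[|//]] ?; [left|right]; exact: val_inj.
    by rewrite tangent0E// -/p -/q dot_cyl; field; rewrite gt_eqF.
  by rewrite a1 tangent1E dotC dot_cyl_turn.
Qed.

End mean_curvature.

(** * The profile of the embedding *)

Section primitive.
Context (R : realType) (f : R -> R) (a b c M : R).
Local Notation mu := (@lebesgue_measure R).
Hypotheses (ac : a <= c) (cb : c <= b) (f_ge0 : forall x, 0 <= f x)
  (f_cont : forall x, a < x < b -> {for x, continuous f})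
  (f_le : forall x, a < x < b -> f x <= M).

Let f_int : mu.-integrable `[a, b] (EFin \o f).
Proof.
apply: measurable_bounded_integrable => //.
- by apply: compact_finite_measure; exact: segment_compact.
- apply: (@measurable_fun_itv_cc _ _ _ false true).
  apply: open_continuous_measurable_fun => // x.
  by rewrite inE/= in_itv/= => /f_cont.
(* The bound [M] concerns the open interval only, so the values at the two ends are added. *)
- exists (`|M| + f a + f b); split; first exact: num_real.
  move=> y /ltW My x /=; rewrite in_itv/= => /andP[ax xb].
  rewrite (le_trans _ My)// ger0_norm//.
  have [->|xa] := eqVneq x a; first by rewrite -addrA addrCA lerDl addr_ge0.
  have [->|xNb] := eqVneq x b; first by rewrite lerDr addr_ge0.
  rewrite -addrA (@le_trans _ _ `|M|) ?lerDl ?addr_ge0//.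
  rewrite (le_trans (f_le _)) ?ler_norm//.
  by rewrite !lt_neqAle eq_sym xa ax xNb xb.
Qed.

Let F x := (\int[mu]_(t in `[a, x]) f t)%R.

Let F_incr x y : a <= x -> x <= y -> y <= b ->
  F y - F x = (\int[mu]_(t in `[x, y]) f t)%R.
Proof.
move=> ax xy yb.
have intS z w : a <= z -> w <= b -> mu.-integrable [set` Interval (BRight z) (BRight w)] (EFin \o f).
  move=> az wb; apply: integrableS f_int => // t /=.
  rewrite !in_itv/= => /andP[zt tw].
  by rewrite (le_trans az (ltW zt)) (le_trans tw wb).
rewrite /F Rintegral_itvB ?bnd_simp//; last first.
  apply: integrableS f_int => // t /=; rewrite !in_itv/= => /andP[-> tw].
  by rewrite (le_trans tw yb).
by rewrite Rintegral_itv_obnd_cbnd//; exact: intS.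
Qed.

(** Expresses both orientations through the single primitive [F] based at the left end [a]. *)
Let orientedE x : a <= x <= b -> oriented_integral c x f = F x - F c.
Proof.
move=> /andP[ax xb]; rewrite /oriented_integral; case: ifPn => [cx|].
  by rewrite F_incr.
by rewrite -ltNge => /ltW xc; rewrite -F_incr// opprB.
Qed.

Lemma oriented_integral_ndecr x y : a <= x -> x <= y -> y <= b ->
  oriented_integral c x f <= oriented_integral c y f.
Proof.
move=> ax xy yb; rewrite !orientedE ?(le_trans ax)// ?yb ?ax ?(le_trans xy)//.
by rewrite lerD2r -subr_ge0 F_incr// Rintegral_ge0.
Qed.

Lemma oriented_integral_continuous :
  {within `[a, b], continuous (fun x => oriented_integral c x f)}.
Proof.
have cF := parameterized_integral_continuous (le_trans ac cb) f_int.
have cG : {within `[a, b], continuous (fun x => F x - F c)}.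
  apply: (@within_continuous_comp _ _ _ _ F (fun y => y - F c)) => // x _.
  by apply: cvgB; [exact: cvg_id|exact: cvg_cst].
move/subspace_continuousP : cG => cG; apply/subspace_continuousP => x xab.
rewrite /from_subspace orientedE; last by move: xab; rewrite /= in_itv.
apply: cvg_trans (cG x xab); apply: near_eq_cvg.
near=> y; rewrite /from_subspace orientedE//.
have : [set` `[a, b]] y by near: y; exact: withinT.
by rewrite /= in_itv.
Unshelve. all: by end_near. Qed.

Lemma oriented_integral_derive x : a < x < b ->
  is_derive x 1 (fun x => oriented_integral c x f) (f x).
Proof.
move=> /andP[ax xb].
have [dF F'] := @continuous_FTC1 R f (BLeft a) x b xb f_int ax (f_cont (introT andP (conj ax xb))).
have FD : is_derive x 1 (fun y => F y - F c) (f x).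
  rewrite -[X in is_derive _ _ _ X]subr0; apply: is_deriveB.
  by rewrite -F' derive1E; exact: derivableP.
apply: near_eq_is_derive FD; near=> y; rewrite orientedE//; apply/andP; split.
- by apply: ltW; near: y; exact: lt_nbhsr.
- by apply: ltW; near: y; exact: lt_nbhsl.
Unshelve. all: by end_near. Qed.

End primitive.

Lemma itv_near (R : realType) (a b x : R) : a < x < b ->
  \forall y \near x, a < y < b.
Proof.
move=> /andP[ax xb]; near=> y; apply/andP; split; near: y.
- exact: lt_nbhsr.
- exact: lt_nbhsl.
Unshelve. all: by end_near. Qed.

Section profile.
Context (R : realType) (K : kerr_like R) (I : set R) (r : R).
Hypotheses (Ir : I r) (smoothK : smooth_kerr_like I K)
  (spacelikeK : spacelike_slice I K) (X_defined : embedding_defined K r)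
  (X_smooth : forall k, smooth_on (@chart R) (fun u => embedding K r u 0 k)).

Let H := gH K r.
Let S := gS K r.
Let e := eta K r.
Let x := xi K r.

Let S_gt0 th : 0 <= th <= pi -> 0 < S th.
Proof. by move=> th_pi; have [] := spacelikeK Ir th_pi. Qed.

Let H_gt0 th : 0 < th < pi -> 0 < H th.
Proof.
move=> /[dup] th_pi /andP[/ltW th0 /ltW thpi].
by have [|_ _] := spacelikeK Ir (th := th); [rewrite th0|exact].
Qed.

Let S_d th : 0 < th < pi -> derivable S th 1.
Proof.
by have [_ _ _ _ sS] := smoothK; exact: (coefficient_derivable_th Ir sS).
Qed.

Lemma eta_gt0 th : 0 < th < pi -> 0 < e th.
Proof. by move=> th_pi; rewrite sqrtr_gt0 H_gt0. Qed.

Lemma eta_sqr th : 0 < th < pi -> e th ^+ 2 = H th.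
Proof. by move=> th_pi; rewrite sqr_sqrtr// ltW// H_gt0. Qed.

Lemma eta_continuous : {within `[0, pi], continuous e}.
Proof.
apply: (@within_continuous_comp _ _ _ _ (gH K r) Num.sqrt).
  by move=> ? _; exact: sqrt_continuous.
by have [_ _ sH _ _] := smoothK; exact: (coefficient_within Ir sH).
Qed.

Lemma eta_derivable2 th : 0 < th < pi ->
  derivable e th 1 /\ derivable (derive1 e) th 1.
Proof.
(* At [phi = 0] the first component of the embedding is [eta] itself. *)
move=> th_pi; have E : (fun a b => eta K r a * cos b)^~ 0 = e.
  by apply/funext => a; rewrite cos0 mulr1.
rewrite -E; apply: (@smooth_on_line0 R (fun a b => eta K r a * cos b)) => //.
have := X_smooth 0; congr smooth_on.
by apply/funext => u; rewrite mxE.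
Qed.

Lemma xi_derivable2 th : 0 < th < pi ->
  derivable x th 1 /\ derivable (derive1 x) th 1.
Proof.
move=> th_pi.
apply: (@smooth_on_line0 R (fun a _ => xi K r a) 0) => //.
have := X_smooth 2; congr smooth_on.
by apply/funext => u; rewrite mxE.
Qed.

(** Near [th], [H = eta ^+ 2]; the [theta]-derivatives in the energy are thus rewritten in terms of
    the profile, as in the formula for [kappa0]. *)
Lemma d_th_H th : 0 < th < pi -> d_th (gH K) r th = 2 * e th * derive1 e th.
Proof.
move=> th_pi; rewrite /d_th derive1E.
have -> : 'D_1 (gH K r) th = 'D_1 (e * e) th.
  apply: near_eq_derive; apply: filterS (itv_near th_pi) => t t_pi.
  by rewrite -/H -eta_sqr.
have d := (eta_derivable2 th_pi).1.
by rewrite (deriveM d d) derive1E /GRing.scale/=; ring.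
Qed.

Lemma d_th_d_th_H th : 0 < th < pi ->
  d_th (d_th (gH K)) r th = 2 * derive1 e th ^+ 2 + 2 * e th * derive1 (derive1 e) th.
Proof.
move=> th_pi; rewrite /d_th derive1E.
have -> : 'D_1 (derive1 (gH K r)) th = 'D_1 (2 \*: (e * derive1 e)) th.
  apply: near_eq_derive; apply: filterS (itv_near th_pi) => t t_pi.
  by have := d_th_H t_pi; rewrite /d_th => ->; rewrite -mulrA.
have [d dd] := eta_derivable2 th_pi.
rewrite (deriveZ 2 (derivableM d dd)) (deriveM d dd) !derive1E /GRing.scale/=.
by rewrite expr2 mulrDr addrC -mulrA.
Qed.

(** The factor [H_theta = 2 eta eta'] cancels the quotient by [H]. Continuity of the integrand of
    [xi] and its bound by [Sigma] are read off from this form. *)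
Lemma xi_radicandE th : 0 < th < pi ->
  xi_radicand K r th = S th ^+ 2 - derive1 e th ^+ 2.
Proof.
move=> th_pi; rewrite /xi_radicand d_th_H// -/H -eta_sqr// -/S.
by field; rewrite gt_eqF// eta_gt0.
Qed.

Let f t := Num.sqrt (xi_radicand K r t).

Let f_cont th : 0 < th < pi -> {for th, continuous f}.
Proof.
move=> th_pi.
have cS : S @ th --> S th.
  by apply/differentiable_continuous/derivable1_diffP; exact: S_d.
have ce : derive1 e @ th --> derive1 e th.
  apply/differentiable_continuous/derivable1_diffP.
  exact: (eta_derivable2 th_pi).2.
have c2 : (fun t => S t * S t - derive1 e t * derive1 e t) @ th -->
    xi_radicand K r th.
  rewrite xi_radicandE// !expr2.
  exact: (cvgB (cvgM cS cS) (cvgM ce ce)).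
have c3 : xi_radicand K r @ th --> xi_radicand K r th.
  apply: cvg_trans c2; apply: near_eq_cvg.
  by apply: filterS (itv_near th_pi) => t t_pi; rewrite xi_radicandE// !expr2.
by apply: continuous_comp; [exact: c3|exact: sqrt_continuous].
Qed.

Let f_le : exists M, forall th, 0 < th < pi -> f th <= M.
Proof.
have S_cont : {within `[0, pi], continuous S}.
  by have [_ _ _ _ sS] := smoothK; exact: (coefficient_within Ir sS).
have [c _ S_max] := EVT_max (@pi_ge0 R) S_cont.
exists (S c) => th /[dup] th_pi /andP[/ltW th0 /ltW thpi].
apply: (@le_trans _ _ (S th)); last by apply: S_max; rewrite in_itv/= th0.
have S0 : 0 < S th by rewrite S_gt0// th0.
rewrite /f xi_radicandE// -[leRHS]gtr0_norm// -sqrtr_sqr ler_wsqrtr//.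
by rewrite gerBl sqr_ge0.
Qed.

Let pi2_ge0 : 0 <= pi / 2 :> R.
Proof. by rewrite divr_ge0 ?pi_ge0. Qed.

Let pi2_le : pi / 2 <= pi :> R.
Proof. by rewrite ler_pdivrMr// ler_peMr ?pi_ge0// ler1n. Qed.

Lemma xi_continuous : {within `[0, pi], continuous x}.
Proof.
have [M f_leM] := f_le.
exact: (oriented_integral_continuous pi2_ge0 pi2_le
  (fun=> sqrtr_ge0 _) f_cont f_leM).
Qed.

Lemma xi_ndecr a b : 0 <= a -> a <= b -> b <= pi -> x a <= x b.
Proof.
have [M f_leM] := f_le.
exact: (oriented_integral_ndecr pi2_ge0 pi2_le
  (fun=> sqrtr_ge0 _) f_cont f_leM).
Qed.

Lemma derive1_xi th : 0 < th < pi -> derive1 x th = f th.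
Proof.
have [M f_leM] := f_le; move=> th_pi.
have := oriented_integral_derive pi2_ge0 pi2_le
  (fun=> sqrtr_ge0 _) f_cont f_leM th_pi.
by move=> xd; rewrite derive1E derive_val.
Qed.

Lemma derive1_xi_ge0 th : 0 < th < pi -> 0 <= derive1 x th.
Proof. by move=> th_pi; rewrite derive1_xi// sqrtr_ge0. Qed.

Lemma speed th : 0 < th < pi ->
  S th ^+ 2 = derive1 e th ^+ 2 + derive1 x th ^+ 2.
Proof.
move=> th_pi; rewrite derive1_xi// sqr_sqrtr ?X_defined// xi_radicandE//.
by rewrite subrKC.
Qed.

(** Half the derivative of [speed]; it accounts for the term [Sigma_theta] of [C]. *)
Lemma speed_derive th : 0 < th < pi ->
  S th * d_th (gS K) r th
  = derive1 e th * derive1 (derive1 e) th + derive1 x th * derive1 (derive1 x) th.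
Proof.
move=> th_pi.
have dS := S_d th_pi; have [_ de] := eta_derivable2 th_pi.
have [_ dx] := xi_derivable2 th_pi.
have : 'D_1 (S * S) th = 'D_1 (derive1 e * derive1 e + derive1 x * derive1 x) th.
  apply: near_eq_derive; apply: filterS (itv_near th_pi) => t t_pi.
  by have := speed t_pi; rewrite !expr2.
rewrite (deriveD (derivableM de de) (derivableM dx dx)).
rewrite (deriveM dS dS) (deriveM de de) (deriveM dx dx) /GRing.scale/=.
have half (a b c : R) : a + a = (b + b) + (c + c) -> a = b + c.
  by move=> abc; lra.
by move=> /half; rewrite /d_th !derive1E.
Qed.

(* [derive1 x >= 0] is minimal where it vanishes. *)
Lemma derive1_xi_eq0 th : 0 < th < pi ->
  derive1 x th = 0 -> derive1 (derive1 x) th = 0.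
Proof.
move=> th_pi x0; rewrite derive1E.
have : is_derive th 1 (derive1 x) 0.
  apply: (@derive1_at_min _ _ 0 pi) => [|t||t].
  - exact: pi_ge0.
  - by rewrite in_itv/= => /xi_derivable2[].
  - by rewrite in_itv.
  - by rewrite in_itv/= x0; exact: derive1_xi_ge0.
by move=> ?; rewrite derive_val.
Qed.

End profile.

(** * Comparison of the two integrands and of the integrals *)

Section densities.
Variable F : realFieldType.

(** Here [p, q] are [eta', xi'], the primed letters are derivatives, and [w] is [pi]. The bracket of
    [C] turns out to be a multiple of [q], which cancels against [beta = 2 * e * q]. *)
Lemma embedded_curvature_density (R s s' e p p' q q' w : F) :
  R != 0 -> s != 0 -> e != 0 -> w != 0 ->
  (q = 0 -> q' = 0) -> s ^+ 2 = p ^+ 2 + q ^+ 2 -> s * s' = p * p' + q * q' ->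
  2 * e ^+ 2 * R ^+ 2 * ((2 * p ^+ 2 + 2 * e * p') * s - 2 * e * p * s'
                         - 2 * s ^+ 3)
    / (16 * w * e * R ^+ 2 * s) * (2 * e * q)^-1
  = - (8 * w)^-1 *
    (((q' * p - p' * q) / s ^+ 3 + q / (s * e)) * (s * e)).
Proof.
move=> R0 s0 e0 w0 qq' sE ssE.
have [q0|q0] := eqVneq q 0.
  by rewrite (qq' q0) q0 !(mulr0, invr0, mul0r, oppr0, addr0).
have -> : (2 * p ^+ 2 + 2 * e * p') * s - 2 * e * p * s' - 2 * s ^+ 3 =
          2 * q * (e * (p' * q - p * q') / s - s * q).
  have -> : s' = (p * p' + q * q') / s by rewrite -ssE mulrC mulKf.
  apply/eqP; rewrite -subr_eq0.
  set D := (X in X == 0).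
  (* Once [s'] is eliminated, the difference contains the factor that vanishes by the speed
     identity. *)
  have -> : D = (2 * s - 2 * e * p' / s) * (p ^+ 2 + q ^+ 2 - s ^+ 2).
    by rewrite /D; field.
  by rewrite sE subrr mulr0.
by field; rewrite R0 s0 e0 w0 q0.
Qed.

(** With [alpha = R * s] and [ell = s ^+ 2], the [r]-derivative in [A] is that of the squared area
    density [(s * e) ^+ 2], while [kappa] contains the logarithmic derivative of [s * e]. *)
Lemma slice_curvature_density (R s e sr hr w : F) :
  R != 0 -> s != 0 -> e != 0 -> w != 0 ->
  s * (hr * s ^+ 2 + e ^+ 2 * (2 * s * sr)) / (16 * w * e * R ^+ 2 * s)
    * (R * s / s ^+ 2)
  = (8 * w)^-1 * (R^-1 * (sr / s + hr / (2 * e ^+ 2)) * (s * e)).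
Proof. by move=> R0 s0 e0 w0; field; rewrite R0 s0 e0 w0. Qed.

End densities.

Section energy.
Context (R : realType) (K : kerr_like R) (I : set R) (t0 r : R).
Hypotheses (Ir : I r) (smoothK : smooth_kerr_like I K)
  (spacelikeK : spacelike_slice I K) (X_defined : embedding_defined K r)
  (eta_0 : eta K r 0 = 0) (eta_pi : eta K r pi = 0)
  (X_smooth : forall k, smooth_on (@chart R) (fun u => embedding K r u 0 k)).

Lemma d_r_area (th : R) : 0 < th < pi ->
  d_r (fun s t => gH K s t * gS K s t ^+ 2) r th =
  d_r (gH K) r th * gS K r th ^+ 2
  + gH K r th * (2 * gS K r th * d_r (gS K) r th).
Proof.
move=> th_pi; have [_ _ sH _ sS] := smoothK.
have dH := coefficient_derivable_r Ir sH th_pi.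
have dS := coefficient_derivable_r Ir sS th_pi.
rewrite /d_r !derive1E.
have -> : (fun s => gH K s th * gS K s th ^+ 2) =
          (gH K)^~ th * ((gS K)^~ th * (gS K)^~ th).
  by apply/funext => s; rewrite expr2.
rewrite (deriveM dH (derivableM dS dS)) (deriveM dS dS) /GRing.scale/=.
rewrite expr2 (_ : ((gS K)^~ th * (gS K)^~ th) r = gS K r th * gS K r th)//.
set a := derive (gS K ^~ th) _ _; set b := derive (gH K ^~ th) _ _.
by move: (gH K r th) (gS K r th) (a : R) (b : R) => h s {}a {}b; ring.
Qed.

Let e_ge0 (th : R) : 0 <= eta K r th. Proof. exact: sqrtr_ge0. Qed.
Let e_gt0 := eta_gt0 Ir spacelikeK.
Let e_cont := eta_continuous Ir smoothK.
Let x_cont := xi_continuous Ir smoothK spacelikeK X_smooth.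
Let x_ndecr := xi_ndecr Ir smoothK spacelikeK X_smooth.
Let e_d (th : R) (h : 0 < th < pi) := (eta_derivable2 X_smooth h).1.
Let e_dd (th : R) (h : 0 < th < pi) := (eta_derivable2 X_smooth h).2.
Let x_d (th : R) (h : 0 < th < pi) := (xi_derivable2 X_smooth h).1.
Let x_dd (th : R) (h : 0 < th < pi) := (xi_derivable2 X_smooth h).2.
Let x_ge0 := derive1_xi_ge0 Ir smoothK spacelikeK X_smooth.
Let spd := speed Ir smoothK spacelikeK X_defined X_smooth.

Let R_gt0 (th : R) : 0 <= th <= pi -> 0 < gR K r th.
Proof. by move=> th_pi; have [] := spacelikeK Ir th_pi. Qed.

Let S_gt0 (th : R) : 0 <= th <= pi -> 0 < gS K r th.
Proof. by move=> th_pi; have [] := spacelikeK Ir th_pi. Qed.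

Let itvW (th : R) : 0 < th < pi -> 0 <= th <= pi.
Proof. by move=> /andP[/ltW -> /ltW ->]. Qed.

Let S_gt0' (th : R) (h : 0 < th < pi) := S_gt0 (itvW h).

Lemma embedding_isometric : isometric_embedding K t0 r (embedding K r).
Proof.
move=> u u_pi; rewrite -[u]pt_coord surface_metricE !pt0.
rewrite (first_fundamental_formE e_d x_d spd)//.
by rewrite (eta_sqr Ir spacelikeK u_pi).
Qed.

Lemma area_density th phi :
  0 <= th <= pi ->
  Num.sqrt (\det (surface_metric K t0 r (pt th phi))) = gS K r th * eta K r th.
Proof.
move=> th_pi; rewrite surface_metricE pt0 det_diag !big_ord_recl big_ord0.
rewrite !mxE/= mulr1 sqrtrM ?sqr_ge0// sqrtr_sqr gtr0_norm//.
exact: S_gt0.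
Qed.

Lemma mean_curvature_embedding th phi : 0 < th < pi ->
  outward_mean_curvature (embedding K r @` @sphere R) (embedding K r) (pt th phi)
  = (derive1 (derive1 (xi K r)) th * derive1 (eta K r) th
     - derive1 (derive1 (eta K r)) th * derive1 (xi K r) th) / gS K r th ^+ 3
    + derive1 (xi K r) th / (gS K r th * eta K r th).
Proof.
move=> th_pi.
apply: (outward_mean_curvatureE e_cont x_cont eta_0 eta_pi e_ge0 e_gt0 x_ndecr
  e_d x_d e_dd x_dd x_ge0 S_gt0' spd _ th_pi).
exact: (derive1_xi_eq0 Ir smoothK spacelikeK X_smooth th_pi).
Qed.

(* Both sides vanish at the poles, where [H = 0]; there [D = 0], so that the
   quotients by [D] are [0] as well. *)
Lemma energy_density th phi :
  let H := gH K r in let Rr := gR K r in let S := gS K r in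
  let H_th := d_th (gH K) r in
  let A := S th * d_r (fun s t => gH K s t * gS K s t ^+ 2) r th in
  let C := 2 * H th * Rr th ^+ 2 *
    (d_th (d_th (gH K)) r th * S th - H_th th * d_th (gS K) r th - 2 * S th ^+ 3) in
  let D := 16 * pi * Num.sqrt (H th) * Rr th ^+ 2 * S th in
  let ell := 0 ^+ 2 + S th ^+ 2 in
  let alpha := Num.sqrt (0 ^+ 2 * S th ^+ 2 + Rr th ^+ 2 * ell) in
  let beta := Num.sqrt (- H_th th ^+ 2 + 4 * H th * ell) in
  0 <= th <= pi ->
  A * H_th th / D * (0 * 0 / (beta * ell)) + A / D * (alpha / ell)
    + C / D * beta^-1
  = - (8 * pi)^-1 *
    ((outward_mean_curvature (embedding K r @` @sphere R) (embedding K r)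
        (pt th phi)
      - @section_mean_curvature R 2 (slice_metric K t0) (slice_normal K) r
          (pt th phi))
     * Num.sqrt (\det (surface_metric K t0 r (pt th phi)))).
Proof.
move=> H Rr S H_th A C D ell alpha beta th_pi.
rewrite area_density//.
have [th_pole|th_in] : (th = 0 \/ th = pi) \/ 0 < th < pi.
  case/andP: th_pi => th0 thpi.
  have [->|th_neq0] := eqVneq th 0; first by left; left.
  have [->|th_neqpi] := eqVneq th pi; first by left; right.
  by right; rewrite !lt_neqAle eq_sym th_neq0 th0 th_neqpi thpi.
  have e0 : eta K r th = 0 by case: th_pole => ->.
  have -> : D = 0 by rewrite /D -[Num.sqrt _]/(eta K r th) e0 !(mulr0, mul0r).
  by rewrite e0 invr0 !(mulr0, mul0r) !addr0.
have R0 := R_gt0 th_pi; have S0 := S_gt0 th_pi; have eta0 := e_gt0 th_in.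
have HE := eta_sqr Ir spacelikeK th_in.
have slice_dS : derivable (fun s => gS K s th) r 1.
  by have [_ _ _ _ sS] := smoothK; exact: (coefficient_derivable_r Ir sS th_in).
have slice : @section_mean_curvature R 2 (slice_metric K t0) (slice_normal K) r
    (pt th phi) = (gR K r th)^-1 * (d_r (gS K) r th / gS K r th
                    + d_r (gH K) r th / (2 * eta K r th ^+ 2)).
  by rewrite HE; apply: slice_mean_curvature => //; rewrite ?gt_eqF// -HE exprn_gt0.
rewrite slice mean_curvature_embedding//.
have ellE : ell = S th ^+ 2 by rewrite /ell expr0n/= add0r.
have alphaE : alpha = Rr th * S th.
  rewrite /alpha ellE expr0n/= mul0r add0r -exprMn sqrtr_sqr gtr0_norm//.
  exact: mulr_gt0.
have x'0 := x_ge0 th_in.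
(* By [speed], the radicand is [4 eta^2 (Sigma^2 - eta'^2) = (2 eta xi')^2], and [xi' >= 0] fixes
   the sign of the root. *)
have betaE : beta = 2 * eta K r th * derive1 (xi K r) th.
  have -> : beta = Num.sqrt ((2 * eta K r th * derive1 (xi K r) th) ^+ 2).
    congr Num.sqrt; rewrite ellE /S (spd th_in) /H_th (d_th_H Ir spacelikeK X_smooth th_in).
    rewrite /H -HE.
    move: (eta K r th) (derive1 (eta K r) th) (derive1 (xi K r) th) => a b c.
    ring.
  by rewrite sqrtr_sqr ger0_norm// !mulr_ge0// ltW.
have DE : D = 16 * pi * eta K r th * Rr th ^+ 2 * S th by [].
have AE : A = S th * (d_r (gH K) r th * S th ^+ 2
                      + eta K r th ^+ 2 * (2 * S th * d_r (gS K) r th)).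
  by rewrite /A d_r_area// HE.
have CE : C = 2 * eta K r th ^+ 2 * Rr th ^+ 2 *
    ((2 * derive1 (eta K r) th ^+ 2
      + 2 * eta K r th * derive1 (derive1 (eta K r)) th) * S th
     - 2 * eta K r th * derive1 (eta K r) th * d_th (gS K) r th - 2 * S th ^+ 3).
  by rewrite /C /H_th (d_th_d_th_H Ir spacelikeK X_smooth th_in) (d_th_H Ir spacelikeK X_smooth th_in) HE.
have pi0 : (pi : R) != 0 by rewrite gt_eqF// pi_gt0.
rewrite mul0r mul0r mulr0 add0r alphaE ellE betaE AE CE DE.
have x''0 := derive1_xi_eq0 Ir smoothK spacelikeK X_smooth th_in.
have SS' := speed_derive Ir smoothK spacelikeK X_defined X_smooth th_in.
rewrite slice_curvature_density// ?gt_eqF//.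
rewrite (embedded_curvature_density _ _ _ _ x''0 (spd th_in) SS')// ?gt_eqF//.
by rewrite [X in _ = _ * X]mulrBl [RHS]mulrDr mulrN !mulNr opprK addrC.
Qed.

(** The integrands agree up to the factor [- (8 * pi)^-1], which leaves both nested integrals by the
    scaling rule valid for arbitrary integrands; its sign cancels that of the energy. *)
Lemma energy_brown_york :
  quasilocal_energy K r (fun=> 0) (fun=> 0)
  = brown_york_mass K t0 r (embedding K r).
Proof.
rewrite /quasilocal_energy /brown_york_mass.
under eq_Rintegral => phi _.
  under eq_Rintegral => th /set_mem.
    rewrite /= in_itv/= => th_pi.
    rewrite (energy_density phi th_pi).
    over.
  rewrite RintegralZl_any.
  over.
by rewrite RintegralZl_any mulNr opprK.
Qed.

End energy.

Theorem theorem2p1 (R : realType) (K : kerr_like R) (I : set R) (t0 r : R)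
  (openI : open I) (Ir : I r)
  (smoothK : smooth_kerr_like I K)
  (spacelikeK : spacelike_slice I K)
  (X_defined : embedding_defined K r)
  (eta_poles : eta K r 0 = 0 /\ eta K r pi = 0)
  (X_smooth : gives_smooth_embedded_closed_surface (embedding K r)) :
  isometric_embedding K t0 r (embedding K r) /\
  quasilocal_energy K r (fun=> 0) (fun=> 0)
    = brown_york_mass K t0 r (embedding K r).
Proof.
case: eta_poles => eta_0 eta_pi; case: X_smooth => smooth _ _ _.
split; first exact: (embedding_isometric t0 Ir).
exact: (energy_brown_york t0 Ir).
Qed.
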